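(* Let $B_R\subset\mathbb{R}^n$ ($n\ge 2$) be the open ball of radius $R$ centered at the origin, let $d(x)=R-|x|$ be the distance from $x\in B_R$ to $\partial B_R$, let $X(t):=(1-\log t)^{-1}$ for $t\in(0,1]$, and let $[s]$ denote the integer part of $s$. (1) For all $u\in C_c^\infty(B_R)$, all $s\ge 2$ and all $\gamma>1$, $$\int_{B_R}\frac{|\nabla u|}{d^{s-1}}dx\ \ge\ (s-1)\int_{B_R}\frac{|u|}{d^s}dx+\sum_{k=1}^{[s]-1}\frac{n-1}{R^k}\int_{B_R}\frac{|u|}{d^{s-k}}dx+\frac{C}{R^{s-1}}\int_{B_R}\frac{|u|}{d}X^\gamma\Big(\frac dR\Big)dx,$$ where $C\ge\gamma-1$. The exponents $s-k$ ($k=1,\dots,[s]-1$) on the distance function and the constants $(n-1)/R^k$ ($k=1,\dots,[s]-1$) in the summation terms are optimal, in the following sense: setting $I_0[u]:=\int_{B_R}\frac{|\nabla u|}{d^{s-1}}dx-(s-1)\int_{B_R}\frac{|u|}{d^s}dx$ and $I_m[u]:=I_0[u]-\sum_{k=1}^m\frac{n-1}{R^k}\int_{B_R}\frac{|u|}{d^{s-k}}dx$ for $m=1,\dots,[s]-1$, one has for every $s\ge2$ and every $m\in\{0,\dots,[s]-2\}$ $$\inf_{u\in C_c^\infty(B_R)\setminus\{0\}}\frac{I_m[u]}{\int_{B_R}\frac{|u|}{d^\beta}dx}=\begin{cases}(n-1)/R^{m+1},&\beta=s-m-1,\\ 0,&\beta>s-m-1.\end{cases}$$ If $\gamma=1$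 the inequality fails, in the sense that $$\inf_{u\in C_c^\infty(B_R)\setminus\{0\}}\frac{I_{[s]-1}[u]}{\int_{B_R}\frac{|u|}{d}X(d/R)dx}=0.$$ (2) For all $u\in C_c^\infty(B_R)$, all $1\le s<2$ and all $\gamma>1$, $$\int_{B_R}\frac{|\nabla u|}{d^{s-1}}dx\ \ge\ (s-1)\int_{B_R}\frac{|u|}{d^s}dx+\frac{C}{R^{s-1}}\int_{B_R}\frac{|u|}{d}X^\gamma\Big(\frac dR\Big)dx,$$ where $C\ge\gamma-1$. If $\gamma=1$ this inequality fails in the sense that $\inf_{u\in C_c^\infty(B_R)\setminus\{0\}} I_0[u]\big/\int_{B_R}\frac{|u|}{d}X(d/R)dx=0$ (here $[s]-1=0$, so $I_{[s]-1}=I_0$).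
   Context: $B_R$ is a ball of radius $R$ centered at the origin in $\mathbb{R}^n$, $d(x)=R-|x|$, so that $-\Delta d(x)=\frac{n-1}{R-d(x)}$ for $x\in B_R\setminus\{0\}$. $X(t)=(1-\log t)^{-1}$ on $(0,1]$. *)

(* Defs.v *)
From HB Require Import structures.
From mathcomp Require Import all_boot all_order all_algebra.
From mathcomp Require Import all_classical all_reals all_analysis.
Set Implicit Arguments. Unset Strict Implicit. Unset Printing Implicit Defensive.
Import Order.TTheory GRing.Theory Num.Theory numFieldNormedType.Exports.
Local Open Scope classical_set_scope.
Local Open Scope ring_scope.

Section hardy_defs.
Variable R : realType.

Definition enorm n (x : 'rV[R]_n) : R := Num.sqrt (\sum_(i < n) x ord0 i ^+ 2).

Fixpoint iter_dir n (vs : seq 'rV[R]_n) (f : 'rV[R]_n -> R) : 'rV[R]_n -> R :=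
  match vs with
  | [::] => f
  | v :: vs' => 'D_v (iter_dir vs' f)
  end.

Definition smooth n (f : 'rV[R]_n -> R) : Prop :=
  forall (vs : seq 'rV[R]_n) (x : 'rV[R]_n), differentiable (iter_dir vs f) x.

(* u in C_c^infty(B_R), extended by zero to R^n: smooth, and its support is
   contained in a closed ball of radius r < R *)
Definition Cc_ball n (R0 : R) (u : 'rV[R]_n -> R) : Prop :=
  smooth u /\ exists r : R, 0 <= r < R0 /\ forall x, r <= enorm x -> u x = 0.

Definition gradnorm n (u : 'rV[R]_n -> R) (x : 'rV[R]_n) : R :=
  Num.sqrt (\sum_(i < n) ('D_(delta_mx 0 i) u x) ^+ 2).

(* Lebesgue integral over R^n as iterated one-dimensional Lebesgue integrals
   (Tonelli; used only for nonnegative measurable integrands) *)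
Fixpoint iint n : ('rV[R]_n -> \bar R) -> \bar R :=
  match n with
  | 0 => fun f => f 0
  | n'.+1 => fun f =>
      (\int[@lebesgue_measure R]_x
         iint (fun y : 'rV[R]_n' => f (row_mx (const_mx x : 'rV[R]_1) y)))%E
  end.

(* integral over B_R of a nonnegative integrand (finite in all uses below) *)
Definition intB n (R0 : R) (g : 'rV[R]_n -> R) : R :=
  fine (iint (fun x => if enorm x < R0 then (g x)%:E else 0%E)).

Definition dist_bd n (R0 : R) (x : 'rV[R]_n) : R := R0 - enorm x.

Definition Xf (t : R) : R := (1 - ln t)^-1.

Definition Grad_term n R0 (s : R) (u : 'rV[R]_n -> R) : R :=
  intB R0 (fun x => gradnorm u x / (dist_bd R0 x) `^ (s - 1)).

Definition Pow_term n R0 (beta : R) (u : 'rV[R]_n -> R) : R :=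
  intB R0 (fun x => `|u x| / (dist_bd R0 x) `^ beta).

Definition Log_term n R0 (gamma : R) (u : 'rV[R]_n -> R) : R :=
  intB R0 (fun x => `|u x| / dist_bd R0 x * (Xf (dist_bd R0 x / R0)) `^ gamma).

Definition I_m n R0 (s : R) (m : nat) (u : 'rV[R]_n -> R) : R :=
  Grad_term R0 s u - (s - 1) * Pow_term R0 s u
  - \sum_(1 <= k < m.+1) ((n - 1)%:R / R0 ^+ k) * Pow_term R0 (s - k%:R) u.

Definition is_infimum (E : set R) (v : R) : Prop :=
  (forall y, E y -> v <= y) /\ (forall e, 0 < e -> exists2 y, E y & y < v + e).

Definition intpart (s : R) : nat := Num.truncn s.

End hardy_defs.

(* Main.v *)
(* Idea.  For a profile phi of d = R - |x|, testing the divergence theorem with the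
   field - phi(d) x / |x| gives
     int |grad u| phi(d) >= int |u| ((n-1) phi(d) / |x| - phi'(d)),
   and phi(d) = d^(1-s) - R^(1-s) X^(gamma-1)(d/R) yields the inequality, since
   (n-1)/(R-d) expands into the geometric series of the correction terms.  Equality holds
   for u radially nonincreasing when phi(d) = d^(1-s); smooth approximations of the
   indicator of the ball then make I_m[u] equal to the remaining term of the series up to
   O(1), while int u X(d/R)/d diverges, which gives the infima.

   All integrands are continuous with compact support, so the iterated integral is handled
   as a positive linear functional on that class.  Its behaviour under dilations replaces
   the divergence theorem and polar coordinates:
   int x.grad f = - n int f, and only derivatives along rays are ever needed. *)
Require Import Defs.
From HB Require Import structures.
From mathcomp Require Import all_boot all_order all_algebra.
From mathcomp Require Import all_classical all_reals all_analysis.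
From mathcomp Require Import ring lra.
Set Implicit Arguments.
Unset Strict Implicit.
Unset Printing Implicit Defensive.
Import Order.TTheory GRing.Theory Num.Theory numFieldNormedType.Exports.
Local Open Scope classical_set_scope.
Local Open Scope ring_scope.

(** * Integration of compactly supported functions on the line *)

Section one_dim.
Variable R : realType.
Notation mu := (@lebesgue_measure R).
Implicit Types f g : R -> R.

Definition cc1 f :=
  (forall e : R, 0 < e -> exists2 d : R, 0 < d & forall s t, `|s - t| < d -> `|f s - f t| <= e) /\
  exists a, forall t, a <= `|t| -> f t = 0.

Lemma cc1_continuous f : cc1 f -> continuous f.
Proof.
move=> [uf _] x; apply/cvgrPdist_le => e e0.
have [d d0 H] := uf e e0.
near=> t; apply: H; near: t.
exact: (@cvgr_dist_lt _ _ _ _ _ (fun t : R => t) x).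
Unshelve. all: by end_near. Qed.

Lemma cc1_integrable f : cc1 f -> mu.-integrable setT (EFin \o f).
Proof.
move=> cf; have [_ [a fa]] := cf.
have fE : f = f \_ `[- a, a].
  apply/funext => t; rewrite patchE; case: ifPn => //.
  rewrite notin_setE /= in_itv /= => /negP; rewrite -ler_norml -ltNge => at_.
  by rewrite fa // ltW.
have H : mu.-integrable `[- a, a] (EFin \o f).
  apply: continuous_compact_integrable; first exact: segment_compact.
  by apply: continuous_subspaceT; exact: cc1_continuous.
rewrite fE -restrict_EFin; apply/integrable_restrict => //.
by rewrite setTI.
Qed.

Definition Int f : R := \int[mu]_x f x.

Lemma IntE f : cc1 f -> (\int[mu]_x (f x)%:E)%E = (Int f)%:E.
Proof.
move=> cf; rewrite /Int /Rintegral fineK //.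
by apply: integrable_fin_num => //; exact: cc1_integrable.
Qed.

Lemma Int_lin c f g : cc1 f -> cc1 g ->
  Int (fun x => c * f x + g x) = c * Int f + Int g.
Proof.
move=> cf cg; rewrite /Int RintegralD //.
- by rewrite RintegralZl //; exact: cc1_integrable.
- have := cc1_integrable cf; move/(integrableZl measurableT c).
  by apply: eq_integrable => //= x _; rewrite EFinM.
- exact: cc1_integrable.
Qed.

Lemma Int_ge0 f : (forall x, 0 <= f x) -> 0 <= Int f.
Proof. by move=> f0; apply: Rintegral_ge0. Qed.

Lemma cc1_scale f (l : R) : 0 < l -> cc1 f -> cc1 (fun x => f (l * x)).
Proof.
move=> l0 [uf [a fa]]; split.
  move=> e e0; have [d d0 H] := uf e e0.
  exists (d / l); first exact: divr_gt0.
  move=> s t st; apply: H.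
  by rewrite -mulrBr normrM gtr0_norm // mulrC -ltr_pdivlMr.
exists (a / l) => t; rewrite ler_pdivrMr // => at_; apply: fa.
by rewrite normrM gtr0_norm // mulrC.
Qed.

Lemma cc1_norm f : cc1 f -> cc1 (fun x => `|f x|).
Proof.
move=> [uf [a fa]]; split.
  move=> e e0; have [d d0 H] := uf e e0.
  by exists d => // s t /H; apply: le_trans; exact: ler_dist_dist.
by exists a => t /fa ->; rewrite normr0.
Qed.

Lemma cc1_lin c f g : cc1 f -> cc1 g -> cc1 (fun x => c * f x + g x).
Proof.
move=> [uf [a fa]] [ug [b gb]]; split.
  move=> e e0.
  have c0 : 0 < 1 + `|c| by rewrite ltr_pwDl.
  have [d d0 H] := uf (e / 2 / (1 + `|c|)) (divr_gt0 (divr_gt0 e0 (ltr0Sn _ 1)) c0).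
  have [d' d'0 H'] := ug (e / 2) (divr_gt0 e0 (ltr0Sn _ 1)).
  exists (Num.min d d'); first by rewrite lt_min d0.
  move=> s t; rewrite lt_min => /andP[/H h /H' h'].
  have -> : c * f s + g s - (c * f t + g t) = c * (f s - f t) + (g s - g t) by ring.
  apply: (le_trans (ler_normD _ _)); rewrite normrM.
  have : `|c| * `|f s - f t| <= e / 2.
    rewrite ler_pdivlMr // in h.
    apply: le_trans h; rewrite mulrC; apply: ler_wpM2l => //; lra.
  by lra.
exists (Num.max a b) => t; rewrite ge_max => /andP[/fa -> /gb ->]; ring.
Qed.

Lemma Int_scale f (l : R) : 0 < l -> cc1 f -> Int (fun x => f (l * x)) = l^-1 * Int f.
Proof.
move=> l0.
have pos h : (forall x, 0 <= h x) -> cc1 h -> Int (fun x => h (l * x)) = l^-1 * Int h.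
  move=> h0 ch; suff : Int h = l * Int (fun x => h (l * x)).
    by move=> ->; rewrite mulKf // gt_eqF.
  apply: EFin_inj; rewrite -(IntE ch).
  have F' (x : R) : is_derive x 1 ( *%R l : R -> R) l.
    have := is_deriveZ l (is_derive_id x (1 : R)).
    by rewrite /GRing.scale /= mulr1.
  have F1 : (( *%R l)^`())%classic = cst l.
    by apply/funext => x; rewrite derive1E; have [_ ->] := F' x.
  rewrite (@increasing_ge0_integration_by_substitutionT R ( *%R l) h) //.
  - rewrite F1 EFinM -(IntE (cc1_scale l0 ch)) -integralZl //.
    + by apply: eq_integral => x _ /=; rewrite /cst /= mulrC EFinM.
    + by apply: cc1_integrable; exact: cc1_scale.
  - by move=> x y xy; rewrite ltr_pM2l.
  - by rewrite F1; exact: cst_continuous.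
  - by rewrite F1; exact: is_cvg_cst.
  - by rewrite F1; exact: is_cvg_cst.
  - under eq_fun do rewrite mulrC.
    by apply: gt0_cvgMlNy => //; exact: cvg_id.
  - under eq_fun do rewrite mulrC.
    by apply: gt0_cvgMly => //; exact: cvg_id.
  - exact: cc1_continuous.
move=> cf.
have cn := cc1_norm cf.
have c1 := cc1_lin 1 cf cn.
have nE x : f x = -1 * `|f x| + (1 * f x + `|f x|) by ring.
have -> : f = (fun x => -1 * `|f x| + (1 * f x + `|f x|)) by apply/funext.
rewrite (Int_lin _ cn c1).
have := Int_lin (-1) (cc1_scale l0 cn) (cc1_scale l0 c1) => /= ->.
rewrite (pos _ _ cn) // (pos _ _ c1); first by rewrite mulrDr mulrCA.
by move=> x; rewrite mul1r; have := ler_norm (- f x); rewrite normrN; lra.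
Qed.

Lemma Int_gt0 f t0 : cc1 f -> (forall x, 0 <= f x) -> 0 < f t0 -> 0 < Int f.
Proof.
move=> cf f0 ft0.
have [uf _] := cf; have [d d0 H] := uf (f t0 / 2) (divr_gt0 ft0 (ltr0Sn _ 1)).
pose A : set R := `[t0 - d / 2, t0 + d / 2]%classic.
have mA : measurable (A : set (measurableTypeR R)) by exact: measurable_itv.
have /integrableP[mf _] := cc1_integrable cf.
rewrite -lte_fin -(IntE cf).
apply: (@lt_le_trans _ _ (\int[mu]_(x in A) (f x)%:E)%E); last first.
  apply: ge0_subset_integral => //.
  by move=> x _; rewrite lee_fin.
apply: (@lt_le_trans _ _ (\int[mu]_(x in A) (f t0 / 2)%:E)%E).
  rewrite integral_cst //= (_ : mu A = d%:E).
    by rewrite -EFinM lte_fin; apply: mulr_gt0; lra.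
  rewrite /A [LHS]lebesgue_measure_itv /= lte_fin ifT; last by lra.
  by rewrite -EFinD; congr (_%:E); lra.
apply: ge0_le_integral => //.
- by move=> *; rewrite lee_fin; apply: divr_ge0.
- by have /integrableP[] := integrableS measurableT mA (@subsetT _ _) (cc1_integrable cf).
move=> x; rewrite /A /= in_itv /= lee_fin => /andP[h1 h2].
have : `|x - t0| < d by rewrite ltr_norml; lra.
by move/H; rewrite ler_norml; lra.
Qed.

End one_dim.

(** * The iterated integral on compactly supported functions *)

Section iterated.
Variable R : realType.

(* Uniform continuity is stated coordinatewise so that it passes to slices at once. *)
Definition cc n (f : 'rV[R]_n -> R) :=
  (forall e : R, 0 < e -> exists2 d : R, 0 < d &
     forall x y : 'rV[R]_n, (forall i, `|x ord0 i - y ord0 i| < d) -> `|f x - f y| <= e) /\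
  exists a : R, forall (x : 'rV[R]_n) i, a <= `|x ord0 i| -> f x = 0.

Definition glue n (t : R) (y : 'rV[R]_n) : 'rV[R]_n.+1 := row_mx (const_mx t : 'rV_1) y.

Fixpoint Lam n : ('rV[R]_n -> R) -> R :=
  match n with
  | 0 => fun f => f 0
  | n'.+1 => fun f => Int (fun t => Lam (fun y => f (glue t y)))
  end.

Lemma glue0 n t (y : 'rV[R]_n) : glue t y ord0 ord0 = t.
Proof.
by rewrite /glue mxE split1 unlift_none /= mxE.
Qed.

Lemma glueS n t (y : 'rV[R]_n) i : glue t y ord0 (lift ord0 i) = y ord0 i.
Proof.
by rewrite /glue mxE split1 liftK.
Qed.

Lemma glueP n (P : R -> R -> Prop) t s (y z : 'rV[R]_n) : P t s ->
  (forall i, P (y ord0 i) (z ord0 i)) -> forall i, P (glue t y ord0 i) (glue s z ord0 i).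
Proof.
move=> P0 PS i; case: (unliftP ord0 i) => [j|] ->; first by rewrite !glueS.
by rewrite !glue0.
Qed.

Lemma glue_scale n (l t : R) (y : 'rV[R]_n) : glue (l * t) (l *: y) = l *: glue t y.
Proof.
apply/rowP => i; rewrite [RHS]mxE.
by case: (unliftP ord0 i) => [j|] ->; rewrite ?glueS ?glue0 // mxE.
Qed.

Lemma glue_eta n (x : 'rV[R]_n.+1) :
  x = glue (x ord0 ord0) (\row_i x ord0 (lift ord0 i)).
Proof.
apply/rowP => i; case: (unliftP ord0 i) => [j|] ->; first by rewrite glueS mxE.
by rewrite glue0.
Qed.

Lemma cc_slice n (f : 'rV[R]_n.+1 -> R) t : cc f -> cc (fun y => f (glue t y)).
Proof.
move=> [uf [a fa]]; split.
  move=> e /uf[d d0 H]; exists d => // x y xy; apply: H.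
  by apply: (@glueP _ (fun a b => `|a - b| < d)) => //; rewrite subrr normr0.
by exists a => y i ay; apply: (fa _ (lift ord0 i)); rewrite glueS.
Qed.

Lemma cc_lin n c (f g : 'rV[R]_n -> R) : cc f -> cc g -> cc (fun x => c * f x + g x).
Proof.
move=> [uf [a fa]] [ug [b gb]]; split.
  move=> e e0.
  have c0 : 0 < 1 + `|c| by rewrite ltr_pwDl.
  have [d d0 H] := uf (e / 2 / (1 + `|c|)) (divr_gt0 (divr_gt0 e0 (ltr0Sn _ 1)) c0).
  have [d' d'0 H'] := ug (e / 2) (divr_gt0 e0 (ltr0Sn _ 1)).
  exists (Num.min d d'); first by rewrite lt_min d0.
  move=> s t st; have /H h : forall i, `|s ord0 i - t ord0 i| < d.
    by move=> i; have := st i; rewrite lt_min => /andP[].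
  have /H' h' : forall i, `|s ord0 i - t ord0 i| < d'.
    by move=> i; have := st i; rewrite lt_min => /andP[].
  have -> : c * f s + g s - (c * f t + g t) = c * (f s - f t) + (g s - g t) by ring.
  apply: (le_trans (ler_normD _ _)); rewrite normrM.
  have : `|c| * `|f s - f t| <= e / 2.
    rewrite ler_pdivlMr // in h.
    apply: le_trans h; rewrite mulrC; apply: ler_wpM2l => //; lra.
  by lra.
exists (Num.max a b) => x i; rewrite ge_max => /andP[/fa -> /gb ->]; ring.
Qed.

Lemma cc_norm n (f : 'rV[R]_n -> R) : cc f -> cc (fun x => `|f x|).
Proof.
move=> [uf [a fa]]; split.
  move=> e e0; have [d d0 H] := uf e e0.
  by exists d => // s t /H; apply: le_trans; exact: ler_dist_dist.
by exists a => t i /fa ->; rewrite normr0.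
Qed.

Lemma cc_scale n (f : 'rV[R]_n -> R) (l : R) : 0 < l -> cc f -> cc (fun x => f (l *: x)).
Proof.
move=> l0 [uf [a fa]]; split.
  move=> e e0; have [d d0 H] := uf e e0.
  exists (d / l); first exact: divr_gt0.
  move=> s t st; apply: H => i.
  by rewrite !mxE -mulrBr normrM gtr0_norm // mulrC -ltr_pdivlMr.
exists (a / l) => t i; rewrite ler_pdivrMr // => at_; apply: (fa _ i).
by rewrite mxE normrM gtr0_norm // mulrC.
Qed.

Definition tent n (x : 'rV[R]_n) : R := Num.max 0 (2 - `|x|).

Lemma coord_le_norm n (x : 'rV[R]_n) i : `|x ord0 i| <= `|x|.
Proof.
rewrite [leRHS]/Num.norm /= mx_normrE; apply/bigmax_geP; right => /=.
by exists (ord0, i).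
Qed.

Lemma norm_le_coord n (x : 'rV[R]_n) a : 0 <= a -> (forall i, `|x ord0 i| <= a) -> `|x| <= a.
Proof.
move=> a0 H; rewrite [leLHS]/Num.norm /= mx_normrE; apply/bigmax_leP; split => // -[j i] _ /=.
by rewrite (ord1 j).
Qed.

Lemma tent_cc n : cc (@tent n).
Proof.
split.
  move=> e e0; exists e => // x y xy.
  have nxy : `|x - y| <= e.
    by apply: norm_le_coord (ltW e0) _ => i; rewrite !mxE ltW.
  have h := le_trans (ler_dist_dist x y) nxy.
  by move: h; rewrite /tent !ler_norml !maxEle; do 2 case: ifPn; rewrite -?ltNge; lra.
exists 2 => x i xi; apply/max_idPl; rewrite subr_le0.
exact: le_trans xi (coord_le_norm _ _).
Qed.

Lemma tent_ge0 n (x : 'rV[R]_n) : 0 <= tent x.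
Proof. by rewrite le_max lexx. Qed.

Lemma tent_ge1 n (x : 'rV[R]_n) : (forall i, `|x ord0 i| <= 1) -> 1 <= tent x.
Proof. by move=> /(norm_le_coord ler01) h; rewrite le_max; apply/orP; right; lra. Qed.

Definition tent_at n (a : R) (x : 'rV[R]_n) : R := tent (a^-1 *: x).

Lemma tent_at_cc n (a : R) : 0 < a -> cc (@tent_at n a).
Proof. by move=> a0; apply: cc_scale (@tent_cc n); rewrite invr_gt0. Qed.

Lemma tent_at_ge0 n (a : R) (x : 'rV[R]_n) : 0 <= tent_at a x.
Proof. exact: tent_ge0. Qed.

Lemma tent_at_ge1 n (a : R) (x : 'rV[R]_n) : 0 < a -> (forall i, `|x ord0 i| <= a) -> 1 <= tent_at a x.
Proof.
move=> a0 H; apply: tent_ge1 => i.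
by rewrite mxE normrM gtr0_norm ?invr_gt0 // ler_pdivrMl // mulr1.
Qed.

Lemma cc_supp_pos n (f : 'rV[R]_n -> R) : cc f ->
  exists2 a : R, 0 < a & forall (x : 'rV[R]_n) i, a <= `|x ord0 i| -> f x = 0.
Proof.
move=> [_ [a fa]]; exists (Num.max 1 a); first by rewrite lt_max ltr01.
by move=> x i; rewrite ge_max => /andP[_ /fa].
Qed.

Lemma cc0 n : cc (fun _ : 'rV[R]_n => 0).
Proof.
by split; [move=> e e0; exists 1 => // *; rewrite subrr normr0 ltW|exists 0].
Qed.

Definition Lam_ok n :=
  (forall c (f g : 'rV[R]_n -> R), cc f -> cc g ->
      Lam (fun x => c * f x + g x) = c * Lam f + Lam g) /\
  (forall f : 'rV[R]_n -> R, cc f -> (forall x, 0 <= f x) -> 0 <= Lam f).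

Lemma Lam_ok_le n (f g : 'rV[R]_n -> R) : Lam_ok n -> cc f -> cc g ->
  (forall x, f x <= g x) -> Lam f <= Lam g.
Proof.
move=> [L P] cf cg fg; rewrite -subr_ge0.
have := P _ (cc_lin (-1) cf cg); rewrite L // => H.
by rewrite addrC -mulN1r; apply: H => x; have := fg x; lra.
Qed.

Lemma Lam_slice_cc1 n (f : 'rV[R]_n.+1 -> R) : Lam_ok n -> cc f ->
  cc1 (fun t => Lam (fun y => f (glue t y))).
Proof.
move=> ok cf; have [L P] := ok.
have L0 : Lam (fun _ : 'rV[R]_n => 0) = 0.
  by have := L (-1) _ _ (@cc0 n) (@cc0 n); rewrite mulr0 addr0 mulN1r addNr.
have [a a0 fa] := cc_supp_pos cf; split; last first.
  exists a => t at_; rewrite -[RHS]L0; congr Lam; apply/funext => y.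
  by apply: (fa _ ord0); rewrite glue0.
move=> e e0; have [uf _] := cf.
set B := Lam (@tent_at n a).
have B0 : 0 <= B by apply: P (tent_at_ge0 _); exact: tent_at_cc.
have B1 : 0 < 1 + B by lra.
have [d d0 H] := uf _ (divr_gt0 e0 B1).
exists d => // s t st.
have key u v : `|u - v| < d -> Lam (fun y => f (glue u y)) - Lam (fun y => f (glue v y)) <= e.
  move=> uv.
  have D := L (-1) _ _ (cc_slice v cf) (cc_slice u cf).
  have D2 := L (e / (1 + B)) _ _ (tent_at_cc n a0) (@cc0 n).
  rewrite addrC -mulN1r -D.
  have /(Lam_ok_le ok) := cc_lin (-1) (cc_slice v cf) (cc_slice u cf).
  move=> /(_ _ (cc_lin (e / (1 + B)) (tent_at_cc n a0) (@cc0 n))) LE.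
  apply: le_trans (LE _) _; last first.
    rewrite D2 L0 addr0 -/B -mulrA ler_piMr ?ltW //.
    by rewrite mulrC ltr_pdivrMr //; lra.
  move=> y; rewrite addr0.
  have h : `|f (glue u y) - f (glue v y)| <= e / (1 + B).
    by apply: H; apply: (@glueP _ (fun a b => `|a - b| < d)) => // i; rewrite subrr normr0.
  have [[i ai]|no] := pselect (exists i, a <= `|y ord0 i|).
    rewrite (fa _ (lift ord0 i)) ?glueS // (fa _ (lift ord0 i)) ?glueS //.
    by rewrite mulr0 addr0; apply: mulr_ge0 (tent_at_ge0 _ _); rewrite divr_ge0 ?ltW.
  have b1 : 1 <= tent_at a y.
    apply: tent_at_ge1 => // i; rewrite leNgt; apply/negP => /ltW ai.
    by apply: no; exists i.
  have : e / (1 + B) <= e / (1 + B) * tent_at a y by rewrite ler_peMr // divr_ge0 ?ltW.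
  by move: h; rewrite ler_norml; lra.
by rewrite ler_norml; have := key _ _ st; rewrite distrC in st; have := key _ _ st; lra.
Qed.

Lemma Lam_okP n : Lam_ok n.
Proof.
elim: n => [|n IH]; first by split => [//|f _ f0]; exact: f0.
have [L P] := IH; split.
  move=> c f g cf cg /=; rewrite -Int_lin; [|exact: Lam_slice_cc1..].
  by congr Int; apply/funext => t; rewrite L //; exact: cc_slice.
move=> f cf f0 /=; apply: Int_ge0 => t; apply: P => //; exact: cc_slice.
Qed.

Lemma Lam_lin n c (f g : 'rV[R]_n -> R) : cc f -> cc g ->
  Lam (fun x => c * f x + g x) = c * Lam f + Lam g.
Proof. by have [L _] := Lam_okP n; exact: L. Qed.

Lemma Lam_ge0 n (f : 'rV[R]_n -> R) : cc f -> (forall x, 0 <= f x) -> 0 <= Lam f.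
Proof. by have [_ P] := Lam_okP n; exact: P. Qed.

Lemma Lam_le n (f g : 'rV[R]_n -> R) : cc f -> cc g ->
  (forall x, f x <= g x) -> Lam f <= Lam g.
Proof. exact: Lam_ok_le (Lam_okP n). Qed.

Lemma Lam0 n : Lam (fun _ : 'rV[R]_n => 0) = 0.
Proof. by have := Lam_lin (-1) (@cc0 n) (@cc0 n); rewrite mulr0 addr0 mulN1r addNr. Qed.

Lemma ccZ n c (f : 'rV[R]_n -> R) : cc f -> cc (fun x => c * f x).
Proof. by move=> cf; have := cc_lin c cf (@cc0 n); under eq_fun do rewrite addr0. Qed.

Lemma LamZ n c (f : 'rV[R]_n -> R) : cc f -> Lam (fun x => c * f x) = c * Lam f.
Proof.
move=> cf; have := Lam_lin c cf (@cc0 n); rewrite Lam0 addr0 => <-.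
by congr Lam; apply/funext => x; rewrite addr0.
Qed.

Lemma ccD n (f g : 'rV[R]_n -> R) : cc f -> cc g -> cc (fun x => f x + g x).
Proof. by move=> cf cg; have := cc_lin 1 cf cg; under eq_fun do rewrite mul1r. Qed.

Lemma LamD n (f g : 'rV[R]_n -> R) : cc f -> cc g ->
  Lam (fun x => f x + g x) = Lam f + Lam g.
Proof.
move=> cf cg; have := Lam_lin 1 cf cg; rewrite mul1r => <-.
by congr Lam; apply/funext => x; rewrite mul1r.
Qed.

Lemma Lam_scale n (f : 'rV[R]_n -> R) (l : R) : 0 < l -> cc f ->
  Lam (fun x => f (l *: x)) = l^-1 ^+ n * Lam f.
Proof.
move=> l0; elim: n f => [|n IH] f cf /=; first by rewrite scaler0 expr0 mul1r.
have E t : Lam (fun y => f (l *: glue t y)) = l^-1 ^+ n * Lam (fun y => f (glue (l * t) y)).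
  have := IH (fun y => f (glue (l * t) y)) (cc_slice _ cf).
  by under eq_fun do rewrite glue_scale.
under eq_fun do rewrite E.
have cF := Lam_slice_cc1 (Lam_okP n) cf.
have c0 : cc1 (fun _ : R => 0 : R).
  by split; [move=> e e0; exists 1 => // *; rewrite subrr normr0 ltW|exists 0].
have I0 : Int (fun _ : R => 0 : R) = 0.
  by have := Int_lin (-1) c0 c0; rewrite mulr0 addr0 mulN1r addNr.
have := Int_lin (l^-1 ^+ n) (cc1_scale l0 cF) c0.
rewrite I0 addr0 (Int_scale l0 cF).
under eq_fun do rewrite addr0.
by move=> ->; rewrite mulrA exprSr.
Qed.

Lemma Lam_gt0 n (f : 'rV[R]_n -> R) x0 : cc f -> (forall x, 0 <= f x) -> 0 < f x0 -> 0 < Lam f.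
Proof.
elim: n f x0 => [|n IH] f x0 cf f0 fx0 /=.
  by rewrite (_ : 0 = x0) //; apply/rowP; case.
apply: (@Int_gt0 R _ (x0 ord0 ord0)).
- exact: Lam_slice_cc1 (Lam_okP n) cf.
- by move=> t; apply: Lam_ge0 => //; exact: cc_slice.
apply: (IH _ (\row_i x0 ord0 (lift ord0 i))) => //; first exact: cc_slice.
by rewrite -glue_eta.
Qed.

Lemma iint_Lam n (f : 'rV[R]_n -> R) : cc f -> iint (fun x => (f x)%:E) = (Lam f)%:E.
Proof.
elim: n f => [//|n IH] f cf /=.
transitivity (\int[@lebesgue_measure R]_t (Lam (fun y => f (glue t y)))%:E)%E.
  by apply: eq_integral => t _; rewrite -IH //; exact: cc_slice.
by rewrite IntE //; exact: Lam_slice_cc1 (Lam_okP n) cf.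
Qed.

Lemma continuous_cc n (f : 'rV[R]_n -> R) (a : R) : continuous f ->
  (forall (x : 'rV[R]_n) i, a <= `|x ord0 i| -> f x = 0) -> cc f.
Proof.
move=> cf fa; split; last by exists a.
move=> e e0.
pose b := Num.max 0 a + 1.
have b0 : 0 <= b by rewrite addr_ge0 // le_max lexx.
pose K := [set x : 'rV[R]_n | forall i, x ord0 i \in `[- b, b]].
have cK : compact K.
  apply: (@rV_compact _ n (fun=> `[- b, b]%classic)).
  by move=> _; exact: segment_compact.
have e20 : 0 < e / 2 by exact: divr_gt0.
have : \forall d \near (0 : R)^'+, K `<=` (fun x => forall y, `|x - y| < d -> `|f x - f y| <= e).
  have /compact_near_coveringP/(_ R (0 : R)^'+
    (fun d x => forall y, `|x - y| < d -> `|f x - f y| <= e)) := cK.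
  apply => x Kx.
  have /cvgrPdist_le/(_ _ e20)/nbhs_ballP[d /= d0 H] := cf x.
  have d20 : 0 < d / 2 by exact: divr_gt0.
  near=> z t => /= y zy.
  have xz : `|x - z| < d / 2.
    by near: z; exact: (@cvgr_dist_lt _ _ _ _ _ (fun z : 'rV[R]_n => z) x).
  have td : t < d / 2 by near: t; exact: nbhs_right_lt.
  have h1 : `|f x - f z| <= e / 2.
    by apply: H; rewrite -ball_normE /ball_ /=; lra.
  have h2 : `|f x - f y| <= e / 2.
    apply: H; rewrite -ball_normE /ball_ /=.
    have -> : x - y = (x - z) + (z - y) by rewrite addrA subrK.
    by apply: (le_lt_trans (ler_normD _ _)); lra.
  by move: h1 h2; rewrite !ler_norml; lra.
move=> near_d.
have [d [d0 d1 Hd]] : exists d : R, [/\ 0 < d, d < 1 & K `<=` (fun x => forall y, `|x - y| < d -> `|f x - f y| <= e)].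
  near (0 : R)^'+ => d; exists d; split.
  - by near: d; exact: nbhs_right_gt.
  - by near: d; exact: nbhs_right_lt.
  - by near: d; exact: near_d.
exists (d / 2); first exact: divr_gt0.
move=> x y xy.
have nxy : `|x - y| < d.
  apply: (@le_lt_trans _ _ (d / 2)); last by lra.
  by apply: norm_le_coord => [|i]; [lra | rewrite !mxE ltW].
have [Kx|nKx] := pselect (K x); first exact: Hd.
have [Ky|nKy] := pselect (K y); first by rewrite distrC; apply: Hd; rewrite // distrC.
have out z : ~ K z -> f z = 0.
  move=> /existsNP[i]; rewrite in_itv /= => /negP; rewrite -ler_norml -ltNge => bz.
  apply: (fa _ i); apply: le_trans (ltW bz); rewrite /b.
  have : a <= Num.max 0 a by rewrite le_max lexx orbT.
  by lra.
by rewrite !out // subrr normr0 ltW.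
Unshelve. all: by end_near. Qed.

End iterated.

(** * Radial weights and the Euler identity *)

Section radial.
Variable R : realType.

Lemma continuous_at_mul (T : topologicalType) (f g : T -> R) (x : T) :
  {for x, continuous f} -> {for x, continuous g} ->
  {for x, continuous (fun y => f y * g y)}.
Proof. exact: continuousM. Qed.

Lemma continuous_at_sum (T : topologicalType) (I : Type) (s : seq I) (F : I -> T -> R) (x : T) :
  (forall i, {for x, continuous (F i)}) ->
  {for x, continuous (fun y => \sum_(i <- s) F i y)}.
Proof.
move=> cF; elim: s => [|i s IH].
  rewrite (_ : (fun y => _) = cst 0); first exact: cvg_cst.
  by apply/funext => y; rewrite big_nil.
rewrite (_ : (fun y => _) = F i \+ (fun y => \sum_(i <- s) F i y)).
  by apply: cvgD; [exact: cF | exact: IH].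
by apply/funext => y; rewrite big_cons.
Qed.

Lemma enorm_ge0 n (x : 'rV[R]_n) : 0 <= enorm x.
Proof. exact: sqrtr_ge0. Qed.

Lemma enorm_sq n (x : 'rV[R]_n) : enorm x ^+ 2 = \sum_(i < n) x ord0 i ^+ 2.
Proof. by rewrite sqr_sqrtr // sumr_ge0 // => i _; exact: sqr_ge0. Qed.

Lemma coord_le_enorm n (x : 'rV[R]_n) i : `|x ord0 i| <= enorm x.
Proof.
rewrite -sqrtr_sqr ler_wsqrtr // (bigD1 i) //= lerDl.
by rewrite sumr_ge0 // => j _; exact: sqr_ge0.
Qed.

Lemma enormZ n (t : R) (x : 'rV[R]_n) : enorm (t *: x) = `|t| * enorm x.
Proof.
rewrite /enorm -sqrtr_sqr -sqrtrM ?sqr_ge0 //; congr Num.sqrt.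
by rewrite mulr_sumr; apply: eq_bigr => i _; rewrite mxE exprMn.
Qed.

Lemma enorm_continuous n : continuous (@enorm R n).
Proof.
move=> x; rewrite /enorm.
apply: (@continuous_comp _ _ _ (fun x : 'rV[R]_n => \sum_(i < n) x ord0 i ^+ 2) Num.sqrt); last exact: sqrt_continuous.
apply: continuous_at_sum => i.
apply: (@continuous_comp _ _ _ (fun x : 'rV[R]_n => x ord0 i) (fun t => t ^+ 2)).
  exact: (@coord_continuous _ _ _ ord0 i x).
exact: exprn_continuous.
Qed.

Lemma continuous_radial n (v : 'rV[R]_n -> R) (om : R -> R) (r0 R0 : R) :
  r0 < R0 -> continuous v -> (forall x, r0 <= enorm x -> v x = 0) ->
  (forall r, 0 <= r < R0 -> {for r, continuous om}) ->
  continuous (fun x => v x * om (enorm x)).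
Proof.
move=> r0R cv v0 com x.
have [xR|Rx] := ltP (enorm x) R0.
  apply: (@continuous_at_mul _ v (fun x => om (enorm x)) x); first exact: cv.
  apply: (@continuous_comp _ _ _ (@enorm R n) om); first exact: enorm_continuous.
  by apply: com; rewrite enorm_ge0.
rewrite /continuous_at v0 ?mul0r; last by rewrite (le_trans (ltW r0R)).
apply: (@cvg_near_cst _ _ 0 _ (nbhs x)); near=> y.
rewrite v0 ?mul0r // ltW //; near: y.
have := @enorm_continuous n x; move/cvgr_gt; apply.
exact: lt_le_trans r0R Rx.
Unshelve. all: by end_near. Qed.

Lemma cc_continuous_enorm n (v : 'rV[R]_n -> R) (r0 : R) :
  continuous v -> (forall x, r0 <= enorm x -> v x = 0) -> cc v.
Proof.
move=> cv v0; apply: (continuous_cc (a := r0)) => // x i xi.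
by apply: v0; apply: le_trans xi (coord_le_enorm _ _).
Qed.

Lemma cc_radial n (v : 'rV[R]_n -> R) (om : R -> R) (r0 R0 : R) :
  r0 < R0 -> continuous v -> (forall x, r0 <= enorm x -> v x = 0) ->
  (forall r, 0 <= r < R0 -> {for r, continuous om}) ->
  cc (fun x => v x * om (enorm x)).
Proof.
move=> r0R cv v0 com; apply: (@cc_continuous_enorm _ _ r0).
  exact: (continuous_radial r0R).
by move=> x /v0 ->; rewrite mul0r.
Qed.

(* [k] is the Euler derivative x.grad f.  In the variable [expR s] no factor [1/t] appears. *)
Definition rad_derive n (f k : 'rV[R]_n -> R) :=
  forall x (s : R), is_derive s 1 (fun s => f (expR s *: x)) (k (expR s *: x)).

Lemma Lam_Nle n (f g : 'rV[R]_n -> R) (e a : R) : 0 < a -> 0 <= e -> cc f -> cc g ->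
  (forall (x : 'rV[R]_n) i, a <= `|x ord0 i| -> f x = 0) ->
  (forall (x : 'rV[R]_n) i, a <= `|x ord0 i| -> g x = 0) ->
  (forall x, `|f x - g x| <= e) -> `|Lam f - Lam g| <= e * Lam (@tent_at R n a).
Proof.
move=> a0 e0 cf cg f0 g0 fg.
have cb := tent_at_cc n a0.
have key (h k : 'rV[R]_n -> R) : cc h -> cc k ->
    (forall (x : 'rV[R]_n) i, a <= `|x ord0 i| -> h x = 0) ->
    (forall (x : 'rV[R]_n) i, a <= `|x ord0 i| -> k x = 0) ->
    (forall x, `|h x - k x| <= e) -> Lam h - Lam k <= e * Lam (@tent_at R n a).
  move=> ch ck h0 k0 hk; rewrite lerBlDr -Lam_lin //.
  apply: Lam_le => //; first exact: cc_lin.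
  move=> x; have [[i ai]|no] := pselect (exists i, a <= `|x ord0 i|).
    by rewrite (h0 _ i) // (k0 _ i) // addr0 mulr_ge0 // tent_at_ge0.
  have b1 : 1 <= tent_at a x.
    apply: tent_at_ge1 => // i; rewrite leNgt; apply/negP => /ltW ai.
    by apply: no; exists i.
  have : e <= e * tent_at a x by rewrite ler_peMr.
  by have := hk x; rewrite ler_norml; lra.
rewrite ler_norml lerNl opprB; apply/andP; split; apply: key => //.
by move=> x; rewrite distrC.
Qed.

Lemma euler n (f k : 'rV[R]_n -> R) : cc f -> cc k -> rad_derive f k ->
  Lam k = - (n%:R * Lam f).
Proof.
move=> cf ck fk.
have [a a0 fa] := cc_supp_pos cf; have [b b0 kb] := cc_supp_pos ck.
pose c := Num.max a b.
have c0 : 0 < c by rewrite lt_max a0.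
have fc (x : 'rV[R]_n) i : c <= `|x ord0 i| -> f x = 0 by rewrite ge_max => /andP[/fa].
have kc (x : 'rV[R]_n) i : c <= `|x ord0 i| -> k x = 0 by rewrite ge_max => /andP[_ /kb].
pose B := Lam (@tent_at R n c).
have B0 : 0 <= B by apply: Lam_ge0 (tent_at_ge0 _); exact: tent_at_cc.
pose N : R := n%:R.
apply/eqP; rewrite -subr_eq0 opprK -normr_le0; apply/ler_addgt0Pr => e e0; rewrite add0r.
have B1 : 0 < 1 + B by lra.
have [uk _] := ck; have [d d0 H] := uk _ (divr_gt0 e0 (mulr_gt0 (ltr0Sn R 1) B1)).
pose L := `|Lam f|.
have L0 : 0 <= L by exact: normr_ge0.
have N0 : 0 <= N by rewrite /N.
have q0 : 0 < 2 * (1 + N ^+ 2 * L) by rewrite mulr_gt0 // ltr_pwDl // mulr_ge0 // sqr_ge0.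
pose s1 := ln (1 + d / (2 * c)).
have s1p : 0 < s1 by rewrite ln_gt0 // ltrDl divr_gt0 // mulr_gt0.
pose s := Num.min s1 (e / (2 * (1 + N ^+ 2 * L))).
have s0 : 0 < s by rewrite lt_min s1p divr_gt0.
have es : expR s * c < c + d.
  have : expR s <= 1 + d / (2 * c).
    rewrite -[leRHS]lnK; first by rewrite ler_expR ge_min lexx.
    by rewrite posrE ltr_pwDl // divr_ge0 ?ltW // mulr_gt0.
  move=> h; apply: (@le_lt_trans _ _ ((1 + d / (2 * c)) * c)); first by rewrite ler_pM2r.
  by rewrite mulrDl mul1r ltrD2l invfM mulrA mulfVK ?gt_eqF // ltr_pdivrMr //; lra.
have e1 : 1 <= expR s by have := expR_ge1Dx s; lra.
have e0' : 0 < expR s by exact: expR_gt0.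
pose g x := s^-1 * (-1 * f x + f (expR s *: x)).
have cfs := cc_scale e0' cf.
have cg : cc g by apply: ccZ; exact: cc_lin.
have gk x : `|g x - k x| <= e / (2 * (1 + B)).
  have [[i ai]|no] := pselect (exists i, c <= `|x ord0 i|).
    rewrite /g (fc _ i) // (kc _ i) // (fc _ i).
      by rewrite !(mulr0, addr0, subr0) normr0 divr_ge0 ?ltW // mulr_gt0.
    rewrite mxE normrM gtr0_norm //; apply: le_trans ai _.
    by rewrite ler_peMl.
  have [xi xis ->] : exists2 xi, xi \in `]0, s[ & g x = k (expR xi *: x).
    have := @MVT R (fun s => f (expR s *: x)) (fun s => k (expR s *: x)) 0 s s0.
    case => [t _|t|t ts E].
    - exact: fk.
    - apply: derivable_within_continuous => u _.
      by have [] := fk x u.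
    exists t => //; rewrite /g mulN1r addrC -[X in _ - f X]scale1r -expR0 E subr0.
    by rewrite mulrC mulfK // gt_eqF.
  apply: H => i; rewrite mxE.
  have xc : `|x ord0 i| < c.
    by rewrite ltNge; apply/negP => ci; apply: no; exists i.
  rewrite -[X in _ - X]mul1r -mulrBl normrM ger0_norm; last first.
    by rewrite subr_ge0 -expR0 ler_expR ltW // (itvP xis).
  have : expR xi <= expR s by rewrite ler_expR ltW // (itvP xis).
  move=> le; apply: (@le_lt_trans _ _ ((expR s - 1) * c)); last by lra.
  apply: ler_pM; rewrite ?(ltW xc) //; last by lra.
  by rewrite subr_ge0 -expR0 ler_expR ltW // (itvP xis).
have gc (x : 'rV[R]_n) i : c <= `|x ord0 i| -> g x = 0.
  move=> ci; rewrite /g (fc _ i) // (fc _ i) ?(mulr0, addr0) //.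
  by rewrite mxE normrM gtr0_norm //; apply: le_trans ci _; rewrite ler_peMl.
have eB : 0 <= e / (2 * (1 + B)) by rewrite divr_ge0 ?ltW // mulr_gt0.
have := Lam_Nle c0 eB cg ck gc kc gk; rewrite -/B => main.
have Bb : e / (2 * (1 + B)) * B <= e / 2.
  rewrite invfM mulrA -mulrA ler_piMr ?divr_ge0 ?ltW //.
  by rewrite mulrC ltr_pdivrMr //; lra.
have gE : Lam g = s^-1 * (expR (- (N * s)) - 1) * Lam f.
  rewrite /g LamZ; last exact: cc_lin.
  rewrite Lam_lin // Lam_scale // expRN expRM_natl exprVn; ring.
pose y := N * s.
have y0 : 0 <= y by rewrite mulr_ge0 // ltW.
have lo : 1 - y <= expR (- y) by exact: expR_ge1Dx.
have up : expR (- y) <= 1 - y + y ^+ 2.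
  rewrite expRN; apply: (@le_trans _ _ (1 + y)^-1).
    by rewrite lef_pV2 ?posrE ?expR_gt0 ?expR_ge1Dx //; lra.
  rewrite -[leLHS]mul1r ler_pdivrMr; last by lra.
  have : 0 <= y ^+ 3 by exact: exprn_ge0.
  by rewrite !exprS expr0; lra.
have : `|Lam g + N * Lam f| <= e / 2.
  have -> : Lam g + N * Lam f = s^-1 * (expR (- y) - 1 + y) * Lam f.
    by rewrite gE /y; field; rewrite gt_eqF.
  rewrite normrM -/L.
  have p0 : 0 <= expR (- y) - 1 + y by lra.
  rewrite normrM (ger0_norm p0) ger0_norm ?invr_ge0 ?(ltW s0) //.
  apply: (@le_trans _ _ (s^-1 * y ^+ 2 * L)).
    rewrite ler_wpM2r // ler_wpM2l ?invr_ge0 ?(ltW s0) //; lra.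
  have -> : s^-1 * y ^+ 2 * L = s * (N ^+ 2 * L).
    by rewrite /y; field; rewrite gt_eqF.
  have : s <= e / (2 * (1 + N ^+ 2 * L)) by rewrite ge_min lexx orbT.
  rewrite ler_pdivlMr // => h.
  have : 0 <= N ^+ 2 * L by rewrite mulr_ge0 // sqr_ge0.
  by nra.
by move: (le_trans main Bb); rewrite !ler_norml -/N; clear; lra.
Qed.

Lemma rad_derive_enorm n (psi kap : R -> R) (R0 : R) x (s : R) :
  kap 0 = 0 -> (forall r, 0 < r < R0 -> is_derive r 1 psi (kap r / r)) ->
  enorm (expR s *: x) < R0 ->
  is_derive s 1 (fun s => psi (@enorm R n (expR s *: x))) (kap (enorm (expR s *: x))).
Proof.
move=> k0 dpsi xR.
have E t : enorm (expR t *: x) = expR t * enorm x.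
  by rewrite enormZ gtr0_norm ?expR_gt0.
under eq_fun do rewrite E.
rewrite E in xR *.
have := enorm_ge0 x; rewrite le_eqVlt => /predU1P[<-|x0].
  rewrite mulr0 k0; under eq_fun do rewrite mulr0.
  exact: is_derive_cst.
have p0 : 0 < expR s * enorm x by rewrite mulr_gt0 ?expR_gt0.
have /dpsi d1 : 0 < expR s * enorm x < R0 by rewrite p0.
have d2 : is_derive s 1 (fun s => expR s * enorm x) (expR s * enorm x).
  apply: is_derive_eq; rewrite /GRing.scale /=; ring.
have := @is_derive1_comp R psi (fun s => expR s * enorm x) s _ _ d1 d2.
by rewrite divfK ?gt_eqF.
Qed.

Lemma rad_derive_mul n (w Dw : 'rV[R]_n -> R) (psi kap : R -> R) (r0 R0 : R) :
  r0 < R0 -> (forall x, r0 <= enorm x -> w x = 0) ->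
  (forall x, r0 <= enorm x -> Dw x = 0) ->
  rad_derive w Dw -> kap 0 = 0 ->
  (forall r, 0 < r < R0 -> is_derive r 1 psi (kap r / r)) ->
  rad_derive (fun x => w x * psi (enorm x))
    (fun x => Dw x * psi (enorm x) + w x * kap (enorm x)).
Proof.
move=> r0R w0 Dw0 dw k0 dpsi x s.
have [xR|Rx] := ltP (enorm (expR s *: x)) R0.
  have d1 := rad_derive_enorm k0 dpsi xR.
  have d2 := dw x s.
  have := @is_deriveM _ _ (fun s => w (expR s *: x)) (fun s => psi (enorm (expR s *: x))) s 1 _ _ d2 d1.
  move/is_derive_eq; apply; rewrite /GRing.scale /=; ring.
rewrite w0 ?Dw0 ?(le_trans (ltW r0R)) // !mul0r addr0.
apply: near_eq_is_derive (@is_derive_cst R R R 0 s 1).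
near=> t; rewrite w0 ?mul0r // ltW //; near: t.
have : {for s, continuous (fun t => enorm (expR t *: x))}.
  apply: (@continuous_comp _ _ _ (fun t => expR t *: x) (@enorm R n)); last exact: enorm_continuous.
  by apply: cvgZ; [exact: continuous_expR | exact: cvg_cst].
move/cvgr_gt; apply.
exact: lt_le_trans r0R Rx.
Unshelve. all: by end_near. Qed.

(* [kap r] stands for [r * psi' r]; no differentiability of [psi] at the origin is required. *)
Lemma euler_radial n (w Dw : 'rV[R]_n -> R) (psi kap : R -> R) (r0 R0 : R) :
  r0 < R0 -> continuous w -> continuous Dw ->
  (forall x, r0 <= enorm x -> w x = 0) ->
  (forall x, r0 <= enorm x -> Dw x = 0) ->
  rad_derive w Dw -> kap 0 = 0 ->
  (forall r, 0 < r < R0 -> is_derive r 1 psi (kap r / r)) ->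
  (forall r, 0 <= r < R0 -> {for r, continuous psi}) ->
  (forall r, 0 <= r < R0 -> {for r, continuous kap}) ->
  Lam (fun x => - Dw x * psi (enorm x)) =
  Lam (fun x => w x * (n%:R * psi (enorm x) + kap (enorm x))).
Proof.
move=> r0R cw cDw w0 Dw0 dw k0 dpsi cpsi ckap.
have c1 : cc (fun x => w x * psi (enorm x)) by exact: cc_radial w0 cpsi.
have c2 : cc (fun x => Dw x * psi (enorm x)) by exact: cc_radial Dw0 cpsi.
have c3 : cc (fun x => w x * kap (enorm x)) by exact: cc_radial w0 ckap.
have := euler c1 (ccD c2 c3) (rad_derive_mul r0R w0 Dw0 dw k0 dpsi).
rewrite LamD // => H.
have -> : Lam (fun x => - Dw x * psi (enorm x)) = -1 * Lam (fun x => Dw x * psi (enorm x)).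
  by rewrite -LamZ //; congr Lam; apply/funext => x; ring.
have -> : Lam (fun x => w x * (n%:R * psi (enorm x) + kap (enorm x))) =
   n%:R * Lam (fun x => w x * psi (enorm x)) + Lam (fun x => w x * kap (enorm x)).
  by rewrite -Lam_lin //; congr Lam; apply/funext => x; ring.
by lra.
Qed.

Lemma derive_sum_coord n (w : 'rV[R]_n -> R) x v : differentiable w x ->
  'D_v w x = \sum_(i < n) v ord0 i * 'D_(delta_mx 0 i) w x.
Proof.
move=> dw; rewrite deriveE // {1}(row_sum_delta v) linear_sum.
by apply: eq_bigr => i _; rewrite linearZ deriveE.
Qed.

Lemma cauchy_schwarz n (a b : 'I_n -> R) :
  (\sum_i a i * b i) ^+ 2 <= (\sum_i a i ^+ 2) * (\sum_i b i ^+ 2).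
Proof.
set A := \sum_i a i ^+ 2; set B := \sum_i b i ^+ 2; set C := \sum_i _.
have B0 : 0 <= B by apply: sumr_ge0 => i _; exact: sqr_ge0.
move: (B0); rewrite le_eqVlt => /predU1P[B00|Bp].
  have b0 i : b i = 0.
    have := psumr_eq0P (fun i _ => sqr_ge0 (b i)) (esym B00).
    by move=> /(_ i isT)/eqP; rewrite sqrf_eq0 => /eqP.
  by rewrite /C big1 ?expr0n /= -?B00 ?mulr0 // => i _; rewrite b0 mulr0.
have : 0 <= \sum_i (B * a i - C * b i) ^+ 2 by apply: sumr_ge0 => i _; exact: sqr_ge0.
have -> : \sum_i (B * a i - C * b i) ^+ 2 = B * (A * B - C ^+ 2).
  transitivity (\sum_i (B ^+ 2 * a i ^+ 2 - 2 * B * C * (a i * b i) + C ^+ 2 * b i ^+ 2)).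
    by apply: eq_bigr => i _; ring.
  rewrite big_split sumrB /= -!mulr_sumr -/A -/B -/C; ring.
by rewrite pmulr_rge0 // subr_ge0.
Qed.

Lemma derive_le_gradnorm n (w : 'rV[R]_n -> R) x : differentiable w x ->
  `|'D_x w x| <= enorm x * gradnorm w x.
Proof.
move=> dw; rewrite derive_sum_coord // /enorm /gradnorm -sqrtrM; last first.
  by rewrite sumr_ge0 // => i _; exact: sqr_ge0.
by rewrite -sqrtr_sqr ler_wsqrtr // cauchy_schwarz.
Qed.

Lemma rad_derive_diff n (w : 'rV[R]_n -> R) : (forall x, differentiable w x) ->
  rad_derive w (fun x => 'D_x w x).
Proof.
move=> dw x s.
have dg : is_diff (s : R) (fun s : R => expR s *: x) (fun h : R => (h * expR s) *: x).
  have de : is_diff s (@expR R) (fun h => h * expR s).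
    apply: DiffDef; first by apply/derivable1_diffP.
    rewrite diff1E; last by apply/derivable1_diffP.
    by have [_ E] := is_derive_expR s; rewrite derive1E E.
  exact: (@is_diff_comp _ _ _ _ expR _ (fun t => t *: x) _ s de (is_diff_scalel _ _)).
have ddg : differentiable (fun s : R => expR s *: x) s by have [] := dg.
have dwg : differentiable (w \o (fun s : R => expR s *: x)) s by exact: differentiable_comp.
apply: DeriveDef; first exact/derivable1_diffP.
rewrite -[LHS]/('D_1 (w \o (fun s : R => expR s *: x)) s) deriveE // diff_comp //=.
have [_ ->] := dg; by rewrite mul1r deriveE.
Qed.

Lemma derive_diag_continuous n (w : 'rV[R]_n -> R) : (forall x, differentiable w x) ->
  (forall v, continuous ('D_v w)) -> continuous (fun x => 'D_x w x).
Proof.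
move=> dw cDw; rewrite (_ : (fun x => _) =
   (fun x : 'rV[R]_n => \sum_(i < n) x ord0 i * 'D_(delta_mx 0 i) w x)); last first.
  by apply/funext => x; rewrite derive_sum_coord.
move=> x; apply: continuous_at_sum => i.
apply: (@continuous_at_mul _ (fun x : 'rV[R]_n => x ord0 i) ('D_(delta_mx 0 i) w) x); first exact: (@coord_continuous _ _ _ ord0 i x).
exact: cDw.
Qed.

Lemma gradnorm_continuous n (w : 'rV[R]_n -> R) :
  (forall v, continuous ('D_v w)) -> continuous (gradnorm w).
Proof.
move=> cDw x; rewrite /gradnorm.
apply: (@continuous_comp _ _ _ (fun x : 'rV[R]_n => \sum_(i < n) ('D_(delta_mx 0 i) w x) ^+ 2) Num.sqrt); last exact: sqrt_continuous.
apply: continuous_at_sum => i.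
apply: (@continuous_comp _ _ _ ('D_(delta_mx 0 i) w) (fun t => t ^+ 2)).
  exact: cDw.
exact: exprn_continuous.
Qed.

Definition tame n (r0 : R) (w : 'rV[R]_n -> R) :=
  [/\ forall x, differentiable w x, forall v, continuous ('D_v w) &
   forall x, r0 <= enorm x -> w x = 0 /\ forall v, 'D_v w x = 0].

Lemma Cc_tame n (R0 : R) (u : 'rV[R]_n -> R) : Cc_ball R0 u ->
  exists2 r0, 0 <= r0 < R0 & tame r0 u.
Proof.
move=> [su [r [/andP[rge rR] ur]]].
exists ((r + R0) / 2); first by apply/andP; split; lra.
split.
- by move=> x; exact: (su [::] x).
- by move=> v x; apply: differentiable_continuous; exact: (su [:: v] x).
move=> x xr; split; first by apply: ur; lra.
move=> v; rewrite (@near_eq_derive _ _ _ u (cst 0)) ?derive_cst //.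
near=> y; apply: ur; rewrite ltW //; near: y.
have := @enorm_continuous n x; move/cvgr_gt; apply; lra.
Unshelve. all: by end_near. Qed.

Lemma gradnorm_eq0 n (r0 : R) (w : 'rV[R]_n -> R) x : tame r0 w -> r0 <= enorm x ->
  gradnorm w x = 0.
Proof.
move=> [_ _ H] /H[_ D0]; rewrite /gradnorm big1 ?sqrtr0 // => i _.
by rewrite D0 expr0n.
Qed.

Lemma gradnorm_ge0 n (w : 'rV[R]_n -> R) x : 0 <= gradnorm w x.
Proof. exact: sqrtr_ge0. Qed.

Lemma intB_Lam n (R0 : R) (g : 'rV[R]_n -> R) : cc g ->
  (forall x, R0 <= enorm x -> g x = 0) -> intB R0 g = Lam g.
Proof.
move=> cg g0; rewrite /intB (_ : (fun x => _) = (fun x => (g x)%:E)).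
  by rewrite iint_Lam.
by apply/funext => x; case: ltP => // /g0 ->.
Qed.

End radial.

(** * The Hardy-type inequality for a radial field *)

Section field.
Variable R : realType.

Lemma cc_continuous n (f : 'rV[R]_n -> R) : cc f -> continuous f.
Proof.
move=> [uf _] x; apply/(@cvgrPdist_le _ _ _ (nbhs x)) => e e0.
have [d d0 H] := uf e e0.
near=> y; apply: H => i.
apply: (@le_lt_trans _ _ `|x - y|).
  by apply: le_trans (coord_le_norm _ i); rewrite !mxE.
by near: y; exact: (@cvgr_dist_lt _ _ _ _ _ (fun z : 'rV[R]_n => z) x).
Unshelve. all: by end_near. Qed.

Lemma cc_bounded n (f : 'rV[R]_n -> R) : cc f ->
  exists2 M : R, 0 <= M & forall x, `|f x| <= M.
Proof.
move=> ccf; have [a a0 fa] := cc_supp_pos ccf.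
pose K := [set x : 'rV[R]_n | forall i, x ord0 i \in `[- a, a]].
have cK : compact K.
  apply: (@rV_compact _ n (fun=> `[- a, a]%classic)).
  by move=> _; exact: segment_compact.
have K0 : K !=set0.
  by exists 0 => i; rewrite mxE in_itv /= oppr_le0 ltW.
have [c _ Hc] := EVT_max_rV K0 cK
  (continuous_subspaceT (cc_continuous (cc_norm ccf))).
exists `|f c|; first exact: normr_ge0.
move=> x; have [Kx|] := pselect (K x); first by apply: Hc; rewrite inE.
move=> /existsNP[i]; rewrite in_itv /= => /negP; rewrite -ler_norml -ltNge => ax.
by rewrite (fa x i (ltW ax)) normr0 normr_ge0.
Qed.

Variable R0 : R.
Hypothesis R0p : 0 < R0.

(* The field is cut off near the origin by [cutoff N = 1 - qq^N = r * cutr N r].  It is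
   nondecreasing in [r], so its derivative [dcut] contributes with the good sign, and
   [qq^N] vanishes at the boundary to order [N], absorbing negative powers of [R0 - r]. *)
Definition qq (r : R) := 1 - r ^+ 2 / R0 ^+ 2.
Definition cutoff N (r : R) := 1 - qq r ^+ N.
Definition cutr N (r : R) := r / R0 ^+ 2 * \sum_(j < N) qq r ^+ j.
Definition dcut N (r : R) := N%:R * qq r ^+ N.-1 * (2 * r / R0 ^+ 2).

Lemma qq_itv r : 0 <= r <= R0 -> 0 <= qq r <= 1.
Proof.
move=> /andP[r0 rR]; have R2 : 0 < R0 ^+ 2 by rewrite exprn_gt0.
rewrite /qq subr_ge0 ler_pdivrMr // mul1r ler_pXn2r ?nnegrE ?(ltW R0p) // rR /=.
by rewrite lerBlDr lerDl divr_ge0 ?sqr_ge0.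
Qed.

Lemma cutr_cutoff N r : r * cutr N r = cutoff N r.
Proof.
have -> : r * cutr N r = - ((qq r - 1) * \sum_(j < N) qq r ^+ j).
  by rewrite -mulNr /cutr mulrA; congr (_ * _); rewrite /qq; field; rewrite gt_eqF.
by rewrite -subrX1 opprB.
Qed.

Lemma cutr_ge0 N r : 0 <= r <= R0 -> 0 <= cutr N r.
Proof.
move=> rR; have /andP[q0 _] := qq_itv rR; case/andP: rR => r0 _.
by rewrite mulr_ge0 ?divr_ge0 ?sqr_ge0 // sumr_ge0 // => j _; exact: exprn_ge0.
Qed.

Lemma cutoff_itv N r : 0 <= r <= R0 -> 0 <= cutoff N r <= 1.
Proof.
move=> rR; have /andP[q0 q1] := qq_itv rR.
by rewrite /cutoff subr_ge0 exprn_ile1 //= lerBlDr lerDl exprn_ge0.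
Qed.

Lemma dcut_ge0 N r : 0 <= r <= R0 -> 0 <= dcut N r.
Proof.
move=> rR; have /andP[q0 _] := qq_itv rR; case/andP: rR => r0 _.
by rewrite !mulr_ge0 ?exprn_ge0 // invr_ge0 sqr_ge0.
Qed.

Lemma cutr0 N : cutr N 0 = 0. Proof. by rewrite /cutr !mul0r. Qed.
Lemma dcut0 N : dcut N 0 = 0. Proof. by rewrite /dcut mulr0 mul0r mulr0. Qed.
Lemma cutoff0 N : cutoff N 0 = 0. Proof. by rewrite -cutr_cutoff mul0r. Qed.

Lemma is_derive_qq (r : R) : is_derive r 1 qq (- (2 * r / R0 ^+ 2)).
Proof.
rewrite /qq; apply: is_derive_eq; rewrite /GRing.scale /=; ring.
Qed.

Lemma is_derive_cutoff N (r : R) : is_derive r 1 (cutoff N) (dcut N r).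
Proof.
have h2 := @is_deriveX _ _ qq N r 1 _ (is_derive_qq r).
have h3 := is_deriveB (is_derive_cst (1 : R) r (1 : R)) h2.
rewrite (_ : cutoff N = cst 1 - qq ^+ N); last by apply/funext => t; rewrite [in RHS]/= exprfctE.
by apply: (is_derive_eq h3); rewrite /dcut /GRing.scale /=; ring.
Qed.

Lemma qq_continuous : continuous qq.
Proof.
move=> r; apply: differentiable_continuous; apply/derivable1_diffP.
by have [] := is_derive_qq r.
Qed.

Lemma qqX_continuous N : continuous (fun r => qq r ^+ N).
Proof.
move=> r; apply: (@continuous_comp _ _ _ qq (fun t => t ^+ N)).
  exact: qq_continuous.
exact: exprn_continuous.
Qed.

Lemma cutoff_continuous N : continuous (cutoff N).
Proof.
move=> r; apply: differentiable_continuous; apply/derivable1_diffP.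
by have [] := is_derive_cutoff N r.
Qed.

Lemma cutr_continuous N : continuous (cutr N).
Proof.
rewrite /cutr => r; apply: (@continuous_at_mul R R (fun r : R => r / R0 ^+ 2) (fun r => \sum_(j < N) qq r ^+ j) r).
  by apply: cvgMl; exact: cvg_id.
by apply: continuous_at_sum => j; exact: qqX_continuous.
Qed.

Lemma dcut_continuous N : continuous (dcut N).
Proof.
rewrite /dcut => r; apply: (@continuous_at_mul R _ (fun r => N%:R * qq r ^+ N.-1) (fun r => 2 * r / R0 ^+ 2) r).
  by apply: cvgMr; exact: qqX_continuous.
by apply: cvgMl; apply: cvgMr; exact: cvg_id.
Qed.

Lemma is_derive_cutr N (r : R) : 0 < r -> is_derive r 1 (cutr N) ((dcut N r - cutr N r) / r).
Proof.
move=> r0.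
have E t : t != 0 -> cutoff N t * t^-1 = cutr N t.
  by move=> t0; rewrite -cutr_cutoff mulrC mulKf.
have h2 := is_deriveV (lt0r_neq0 r0 : id r != 0) (is_derive_id r (1 : R)).
have h := @is_deriveM _ _ (cutoff N) (fun t => t^-1) r 1 _ _ (is_derive_cutoff N r) h2.
have h' := is_derive_eq h (_ : _ = (dcut N r - cutr N r) / r).
apply: near_eq_is_derive (h' _); last first.
  by rewrite -E ?gt_eqF // /GRing.scale /=; field; rewrite gt_eqF.
near=> t; rewrite /= -E // gt_eqF //; near: t.
exact: lt_nbhsr.
Unshelve. all: by end_near. Qed.

Definition nice_profile (phi dphi : R -> R) :=
  forall d : R, 0 < d <= R0 -> is_derive d 1 phi (dphi d) /\ {for d, continuous dphi}.

Lemma nice_profile_continuous phi dphi d : nice_profile phi dphi -> 0 < d <= R0 ->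
  {for d, continuous phi}.
Proof.
move=> np /np[[h _] _]; apply: differentiable_continuous; exact/derivable1_diffP.
Qed.

Lemma refl_continuous (f : R -> R) r : {for R0 - r, continuous f} ->
  {for r, continuous (fun r => f (R0 - r))}.
Proof.
move=> cf; apply: (@continuous_comp _ _ _ (fun r => R0 - r) f) => //.
by apply: cvgB; [exact: cvg_cst | exact: cvg_id].
Qed.

Lemma euler_cut n (w Dw : 'rV[R]_n -> R) (phi dphi : R -> R) (r0 : R) N :
  (0 < n)%N -> r0 < R0 -> continuous w -> continuous Dw ->
  (forall x, r0 <= enorm x -> w x = 0) ->
  (forall x, r0 <= enorm x -> Dw x = 0) ->
  rad_derive w Dw -> nice_profile phi dphi ->
  Lam (fun x => - Dw x * (cutr N (enorm x) * phi (R0 - enorm x))) =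
  Lam (fun x => w x * ((n - 1)%:R * (cutr N (enorm x) * phi (R0 - enorm x)) +
    dcut N (enorm x) * phi (R0 - enorm x) - cutoff N (enorm x) * dphi (R0 - enorm x))).
Proof.
move=> n0 r0R cw cDw w0 Dw0 dw np.
pose psi r := cutr N r * phi (R0 - r).
pose kap r := (dcut N r - cutr N r) * phi (R0 - r) - cutoff N r * dphi (R0 - r).
have dd r : 0 <= r < R0 -> 0 < R0 - r <= R0.
  by move=> /andP[r1 r2]; rewrite subr_gt0 r2 /= lerBlDr lerDl.
have cphi r : 0 <= r < R0 -> {for r, continuous (fun r => phi (R0 - r))}.
  by move=> /dd h; apply: refl_continuous; exact: (nice_profile_continuous np h).
have cdphi r : 0 <= r < R0 -> {for r, continuous (fun r => dphi (R0 - r))}.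
  by move=> /dd h; apply: refl_continuous; have [] := np _ h.
apply: (etrans (@euler_radial R n w Dw psi kap r0 R0 r0R cw cDw w0 Dw0 dw _ _ _ _)).
- by rewrite /kap dcut0 cutr0 cutoff0 subr0 !mul0r subr0.
- move=> r /andP[r1 r2].
  have /dd/np[h1 _] : 0 <= r < R0 by rewrite (ltW r1) r2.
  have h2 := is_derive_cutr N r1.
  have h3 : is_derive r 1 (fun r => R0 - r) (-1).
    by apply: is_derive_eq; ring.
  have h4 := @is_derive1_comp R phi (fun r => R0 - r) r _ _ h1 h3.
  have h5 := @is_deriveM _ _ (cutr N) (fun r => phi (R0 - r)) r 1 _ _ h2 h4.
  apply: (is_derive_eq h5); rewrite /GRing.scale /= /kap -cutr_cutoff; field.
  by rewrite gt_eqF.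
- move=> r rR; apply: (@continuous_at_mul R _ (cutr N) (fun r => phi (R0 - r)) r).
    exact: cutr_continuous.
  exact: cphi.
- move=> r rR; apply: cvgB.
    apply: (@continuous_at_mul R _ (fun r => dcut N r - cutr N r) (fun r => phi (R0 - r)) r); last exact: cphi.
    by apply: cvgB; [exact: dcut_continuous | exact: cutr_continuous].
  apply: (@continuous_at_mul R _ (cutoff N) (fun r => dphi (R0 - r)) r).
    exact: cutoff_continuous.
  exact: cdphi.
by congr Lam; apply/funext => x; congr (_ * _); rewrite /psi /kap natrB //; ring.
Qed.

(* [sabs dl] is a smooth approximation of the absolute value from below,
   vanishing at [0] so that supports are preserved. *)
Definition sabs (dl t : R) := Num.sqrt (t ^+ 2 + dl ^+ 2) - dl.

Lemma sabs0 dl : 0 < dl -> sabs dl 0 = 0.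
Proof. by move=> d0; rewrite /sabs expr0n add0r sqrtr_sqr gtr0_norm // subrr. Qed.

Lemma sabs_bounds dl t : 0 < dl -> `|t| - dl <= sabs dl t <= `|t|.
Proof.
move=> d0; rewrite /sabs lerD2r lerBlDr -sqrtr_sqr ler_wsqrtr ?lerDl ?sqr_ge0 //=.
rewrite sqrtr_sqr -[leRHS]ger0_norm; last by rewrite addr_ge0 // ltW.
rewrite -[leRHS]sqrtr_sqr ler_wsqrtr // sqrrD real_normK ?num_real //.
rewrite lerD2r lerDl mulrn_wge0 // mulr_ge0 // ltW //.
Qed.

Lemma sabs_ge0 dl t : 0 < dl -> 0 <= sabs dl t.
Proof.
move=> d0; rewrite /sabs subr_ge0 -[leLHS]gtr0_norm // -sqrtr_sqr ler_wsqrtr //.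
by rewrite lerDr sqr_ge0.
Qed.

Lemma is_derive_sabs dl (t : R) : 0 < dl ->
  is_derive t 1 (sabs dl) (t / Num.sqrt (t ^+ 2 + dl ^+ 2)).
Proof.
move=> d0.
have p : 0 < t ^+ 2 + dl ^+ 2 by rewrite ltr_wpDl ?sqr_ge0 // exprn_gt0.
have h1 : is_derive t 1 (fun t => t ^+ 2 + dl ^+ 2) (2 * t).
  by apply: is_derive_eq; rewrite /GRing.scale /=; ring.
have h2 := @is_derive1_comp R Num.sqrt (fun t => t ^+ 2 + dl ^+ 2) t _ _ (is_derive1_sqrt p) h1.
have h3 := @is_deriveB _ _ _ _ (cst dl) t 1 _ _ h2 (is_derive_cst dl t 1).
apply: (is_derive_eq h3); rewrite subr0; field.
by rewrite gt_eqF // sqrtr_gt0.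
Qed.

Lemma dsabs_le1 (dl t : R) : 0 < dl -> `|t / Num.sqrt (t ^+ 2 + dl ^+ 2)| <= 1.
Proof.
move=> d0.
have p : 0 < t ^+ 2 + dl ^+ 2 by rewrite ltr_wpDl ?sqr_ge0 // exprn_gt0.
rewrite normrM normfV (gtr0_norm (_ : 0 < Num.sqrt _)) ?sqrtr_gt0 //.
rewrite ler_pdivrMr ?sqrtr_gt0 // mul1r -sqrtr_sqr ler_wsqrtr //.
by rewrite lerDl sqr_ge0.
Qed.

Lemma expr_small (b e : R) : 0 <= b < 1 -> 0 < e -> exists N, b ^+ N <= e.
Proof.
move=> /andP[b0 b1] e0.
have := @cvg_expr R b; rewrite ger0_norm // => /(_ b1)/cvgrPdist_le/(_ _ e0)[N _ H].
exists N; have := H N (leqnn N).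
by rewrite /= sub0r normrN ger0_norm // exprn_ge0.
Qed.

(* The only loss against [Lam (|u| G)] is near the origin, where [cutoff N] vanishes,
   and through [sabs]; both are sent to zero. *)
Lemma hardy_field n (u : 'rV[R]_n -> R) (phi dphi Phi G : R -> R) (r0 : R) :
  (0 < n)%N -> 0 <= r0 < R0 -> tame r0 u -> nice_profile phi dphi ->
  (forall d, 0 < d <= R0 -> 0 <= phi d <= Phi d) ->
  (forall d, 0 < d <= R0 -> {for d, continuous Phi}) ->
  (forall r, 0 <= r < R0 -> {for r, continuous G}) ->
  (forall r, 0 <= r < R0 -> 0 <= G r) ->
  (forall r, 0 < r < R0 -> G r <= (n - 1)%:R * phi (R0 - r) / r - dphi (R0 - r)) ->
  Lam (fun x => `|u x| * G (enorm x)) <=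
  Lam (fun x => gradnorm u x * Phi (R0 - enorm x)).
Proof.
move=> n0 /andP[r00 r0R] tu np phiP cPhi cG G0 Gle.
have [du cDu u0] := tu.
have dd r : 0 <= r < R0 -> 0 < R0 - r <= R0.
  by move=> /andP[r1 r2]; rewrite subr_gt0 r2 /= lerBlDr lerDl.
have cu : continuous u by move=> x; exact: differentiable_continuous.
have cDD := derive_diag_continuous du cDu.
have cnu : continuous (fun x => `|u x|).
  by move=> x; apply: (@continuous_comp _ _ _ u (fun t => `|t|)); [exact: cu | exact: norm_continuous].
have u0' x : r0 <= enorm x -> `|u x| = 0 by move=> /u0[-> _]; rewrite normr0.
have g0 x : r0 <= enorm x -> gradnorm u x = 0 by exact: (gradnorm_eq0 tu).
have cPhi' r : 0 <= r < R0 -> {for r, continuous (fun r => Phi (R0 - r))}.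
  by move=> /dd h; apply: refl_continuous; exact: cPhi.
have ccF : cc (fun x => `|u x| * G (enorm x)) by exact: cc_radial u0' cG.
have ccg : cc (fun x => gradnorm u x * Phi (R0 - enorm x)).
  by apply: (cc_radial r0R _ g0 cPhi'); exact: gradnorm_continuous.
set A := Lam (fun x => gradnorm u x * Phi (R0 - enorm x)).
have step dl N : 0 < dl ->
    cc (fun x => sabs dl (u x) * (cutoff N (enorm x) * G (enorm x))) /\
    Lam (fun x => sabs dl (u x) * (cutoff N (enorm x) * G (enorm x))) <= A.
  move=> dl0.
  pose w x := sabs dl (u x).
  pose Dw x := u x / Num.sqrt (u x ^+ 2 + dl ^+ 2) * 'D_x u x.
  have sp t : 0 < t ^+ 2 + dl ^+ 2 by rewrite ltr_wpDl ?sqr_ge0 // exprn_gt0.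
  have csabs : continuous (sabs dl).
    move=> t; apply: differentiable_continuous; apply/derivable1_diffP.
    by have [] := is_derive_sabs t dl0.
  have cw : continuous w.
    by move=> x; apply: (@continuous_comp _ _ _ u (sabs dl)); [exact: cu|exact: csabs].
  have cDw : continuous Dw.
    move=> x; apply: (@continuous_at_mul R _ (fun x => u x / Num.sqrt (u x ^+ 2 + dl ^+ 2)) (fun x => 'D_x u x) x); last exact: cDD.
    apply: (@continuous_comp _ _ _ u (fun t => t / Num.sqrt (t ^+ 2 + dl ^+ 2))); first exact: cu.
    move: (u x) => t; apply: cvgM; first exact: cvg_id.
    apply: cvgV; first by rewrite gt_eqF // sqrtr_gt0.
    have -> : (fun t : R => Num.sqrt (t ^+ 2 + dl ^+ 2)) = (fun t => sabs dl t + dl).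
      by apply/funext => y; rewrite /sabs subrK.
    have -> : Num.sqrt (t ^+ 2 + dl ^+ 2) = sabs dl t + dl by rewrite /sabs subrK.
    by apply: cvgD; [exact: csabs | exact: cvg_cst].
  have w0 x : r0 <= enorm x -> w x = 0 by move=> /u0[h _]; rewrite /w h sabs0.
  have Dw0 x : r0 <= enorm x -> Dw x = 0 by move=> /u0[_ h]; rewrite /Dw h mulr0.
  have rdw : rad_derive w Dw.
    move=> x s.
    have h1 := is_derive_sabs (u (expR s *: x)) dl0.
    have h2 := rad_derive_diff du x s.
    exact: (@is_derive1_comp R (sabs dl) (fun s => u (expR s *: x)) s _ _ h1 h2).
  have cphi r : 0 <= r < R0 -> {for r, continuous (fun r => phi (R0 - r))}.
    by move=> /dd h; apply: refl_continuous; exact: (nice_profile_continuous np h).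
  have cdphi r : 0 <= r < R0 -> {for r, continuous (fun r => dphi (R0 - r))}.
    by move=> /dd h; apply: refl_continuous; have [] := np _ h.
  have E := euler_cut N n0 r0R cw cDw w0 Dw0 rdw np.
  have c1 : cc (fun x => w x * (cutoff N (enorm x) * G (enorm x))).
    apply: (cc_radial (om := fun r => cutoff N r * G r) r0R cw w0) => r rR.
    by apply: (@continuous_at_mul R _ (cutoff N) G r); [exact: cutoff_continuous | exact: cG].
  split => //.
  have c2 : cc (fun x => - Dw x * (cutr N (enorm x) * phi (R0 - enorm x))).
    apply: (cc_radial (v := fun x => - Dw x) (om := fun r => cutr N r * phi (R0 - r)) r0R).
    - by move=> x; exact: (continuousN (cDw x)).
    - by move=> x /Dw0 ->; rewrite oppr0.
    move=> r rR; apply: (@continuous_at_mul R _ (cutr N) (fun r => phi (R0 - r)) r).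
      exact: cutr_continuous.
    exact: cphi.
  have c3 : cc (fun x => w x * ((n - 1)%:R * (cutr N (enorm x) * phi (R0 - enorm x)) +
    dcut N (enorm x) * phi (R0 - enorm x) - cutoff N (enorm x) * dphi (R0 - enorm x))).
    apply: (cc_radial (om := fun r => (n - 1)%:R * (cutr N r * phi (R0 - r)) +
      dcut N r * phi (R0 - r) - cutoff N r * dphi (R0 - r)) r0R cw w0) => r rR.
    apply: cvgB; first (apply: cvgD; first apply: cvgMr).
    - apply: (@continuous_at_mul R _ (cutr N) (fun r => phi (R0 - r)) r).
        exact: cutr_continuous.
      exact: cphi.
    - apply: (@continuous_at_mul R _ (dcut N) (fun r => phi (R0 - r)) r).
        exact: dcut_continuous.
      exact: cphi.
    apply: (@continuous_at_mul R _ (cutoff N) (fun r => dphi (R0 - r)) r).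
      exact: cutoff_continuous.
    exact: cdphi.
  apply: (le_trans (Lam_le c1 c3 _)).
    move=> x; have [xR|Rx] := ltP (enorm x) R0; last by rewrite w0 ?mul0r // (le_trans (ltW r0R)).
    apply: ler_wpM2l; first exact: sabs_ge0.
    have r0' := enorm_ge0 x; move: (enorm x) xR r0' => r rR r1.
    have rRR : 0 <= r < R0 by rewrite r1.
    have rRR' : 0 <= r <= R0 by rewrite r1 ltW.
    have /andP[p0 _] := phiP _ (dd _ rRR).
    have := r1; rewrite le_eqVlt => /predU1P[<-|rp].
      by rewrite cutoff0 cutr0 dcut0 !(mul0r, mulr0) addr0 subrr.
    have h1 : cutoff N r * G r <= cutoff N r * ((n - 1)%:R * phi (R0 - r) / r - dphi (R0 - r)).
      apply: ler_wpM2l; first by case/andP: (cutoff_itv N rRR').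
      by apply: Gle; rewrite rp.
    have h2 : 0 <= dcut N r * phi (R0 - r) by rewrite mulr_ge0 // dcut_ge0.
    have h3 : cutoff N r * ((n - 1)%:R * phi (R0 - r) / r - dphi (R0 - r)) =
       (n - 1)%:R * (cutr N r * phi (R0 - r)) - cutoff N r * dphi (R0 - r).
      by rewrite -cutr_cutoff; field; rewrite gt_eqF.
    by lra.
  rewrite -E; apply: Lam_le => // x.
  have [xR|Rx] := ltP (enorm x) R0; last first.
    by rewrite Dw0 ?g0 ?oppr0 ?mul0r // (le_trans (ltW r0R)).
  have rRR : 0 <= enorm x < R0 by rewrite enorm_ge0.
  have rRR' : 0 <= enorm x <= R0 by rewrite enorm_ge0 ltW.
  have /andP[p0 p1] := phiP _ (dd _ rRR).
  have h1 : - Dw x <= enorm x * gradnorm u x.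
    apply: (le_trans _ (derive_le_gradnorm (du x))).
    apply: le_trans (ler_norm _) _; rewrite normrN normrM.
    by rewrite ler_piMl // dsabs_le1.
  have h2 : 0 <= cutr N (enorm x) * phi (R0 - enorm x) by rewrite mulr_ge0 // cutr_ge0.
  apply: (le_trans (ler_wpM2r h2 h1)).
  rewrite [leLHS](_ : _ = gradnorm u x * (cutoff N (enorm x) * phi (R0 - enorm x))); last by rewrite -cutr_cutoff; ring.
  apply: ler_wpM2l; first exact: gradnorm_ge0.
  apply: le_trans p1; rewrite ler_piMl //.
  by case/andP: (cutoff_itv N rRR').
have [MF MF0 MFle] := cc_bounded ccF.
have [MG MG0 MGle] : exists2 M : R, 0 <= M & forall r, 0 <= r <= r0 -> G r <= M.
  have cGs : {within `[0, r0], continuous G}.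
    apply: continuous_in_subspaceT => r; rewrite inE /= in_itv /= => /andP[h1 h2].
    by apply: cG; rewrite h1 (le_lt_trans h2).
  have [c cr Hc] := EVT_max r00 cGs.
  exists (G c); last by move=> r rr; apply: Hc; rewrite in_itv.
  by apply: G0; move: cr; rewrite in_itv /= => /andP[-> h]; exact: le_lt_trans r0R.
have [a a0 Fa] := cc_supp_pos ccF.
pose B := Lam (@tent R n).
have B0 : 0 <= B by apply: Lam_ge0 (@tent_ge0 R n); exact: tent_cc.
have Bat (c : R) : 0 < c -> Lam (@tent_at R n c) = c ^+ n * B.
  move=> c0; rewrite /tent_at Lam_scale ?invr_gt0 ?invrK //; exact: tent_cc.
apply/ler_addgt0Pr => e e0.
pose b := Num.min (R0 / 2) (Num.min 1 (e / 3 / (1 + MF * B))).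
have MB : 0 < 1 + MF * B by rewrite ltr_pwDl // mulr_ge0.
have b0 : 0 < b by rewrite !lt_min ltr01 !divr_gt0.
have bR : b <= R0 / 2 by rewrite ge_min lexx.
have b1 : b <= 1 by rewrite !ge_min lexx !orbT.
have be : b * (1 + MF * B) <= e / 3.
  by rewrite -ler_pdivlMr // !ge_min lexx !orbT.
have eb : MF * (b ^+ n * B) <= e / 3.
  apply: le_trans be; rewrite mulrCA.
  apply: (@le_trans _ _ (b * (MF * B))); last by rewrite ler_pM2l //; lra.
  rewrite ler_wpM2r ?mulr_ge0 // -[leRHS]expr1.
  by apply: ler_wiXn2l; rewrite ?(ltW b0).
have qb : 0 <= qq b < 1.
  have /andP[q0 _] : 0 <= qq b <= 1 by apply: qq_itv; rewrite ltW //=; lra.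
  by rewrite q0 /= /qq ltrBlDr ltrDl divr_gt0 ?exprn_gt0.
pose Q := 1 + MF * (a ^+ n * B).
have a_n : 0 <= a ^+ n * B by rewrite mulr_ge0 // exprn_ge0 // ltW.
have Q0 : 0 < Q by rewrite ltr_pwDl // mulr_ge0.
have [N qN] := expr_small qb (divr_gt0 (divr_gt0 e0 (ltr0Sn R 2)) Q0).
pose P := 1 + MG * (a ^+ n * B).
have P0 : 0 < P by rewrite ltr_pwDl // mulr_ge0.
pose dl := e / 3 / P.
have dl0 : 0 < dl by rewrite !divr_gt0.
have [c1 h1] := step dl N dl0.
have cba := tent_at_cc n a0. have cbb := tent_at_cc n b0.
pose k := dl * MG + MF * qq b ^+ N.
have qb0 : 0 <= qq b by case/andP: qb.
have qbN : 0 <= qq b ^+ N by exact: exprn_ge0.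
have k0 : 0 <= k by apply: addr_ge0; apply: mulr_ge0 => //; exact: ltW.
have main : Lam (fun x => `|u x| * G (enorm x)) <=
   Lam (fun x => sabs dl (u x) * (cutoff N (enorm x) * G (enorm x))) +
   (k * (a ^+ n * B) + MF * (b ^+ n * B)).
  rewrite -(Bat a a0) -(Bat b b0) -[X in _ + (_ + X)]LamZ // -[X in _ + X]Lam_lin //; last exact: ccZ.
  have cr : cc (fun x => k * tent_at a x + MF * @tent_at R n b x) by apply: cc_lin => //; exact: ccZ.
  rewrite -LamD //; apply: Lam_le => //; first exact: ccD.
  move=> x.
  have ba0 := tent_at_ge0 a x; have bb0 := tent_at_ge0 b x.
  have [rx|xr] := leP r0 (enorm x).
    have [uu _] := u0 _ rx; rewrite uu normr0 sabs0 // !mul0r add0r.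
    by rewrite addr_ge0 // mulr_ge0.
  have xR : 0 <= enorm x <= R0 by rewrite enorm_ge0 ltW // (lt_trans xr).
  have Gx : G (enorm x) <= MG by apply: MGle; rewrite enorm_ge0 ltW.
  have Gx0 : 0 <= G (enorm x) by apply: G0; rewrite enorm_ge0 (lt_trans xr).
  have /andP[s1 s2] := sabs_bounds (u x) dl0.
  have /andP[ch0 ch1] := cutoff_itv N xR.
  have /andP[q0 q1] := qq_itv xR.
  have Fx : `|u x| * G (enorm x) <= MF.
    by apply: le_trans (ler_norm _) (MFle x).
  have Fx0 : 0 <= `|u x| * G (enorm x) by rewrite mulr_ge0.
  have split_ : `|u x| * G (enorm x) <= sabs dl (u x) * (cutoff N (enorm x) * G (enorm x)) +
      (dl * MG + (`|u x| * G (enorm x)) * qq (enorm x) ^+ N).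
    have -> : qq (enorm x) ^+ N = 1 - cutoff N (enorm x) by rewrite /cutoff; ring.
    have : (`|u x| - sabs dl (u x)) * (cutoff N (enorm x) * G (enorm x)) <= dl * MG.
      apply: ler_pM; [by rewrite subr_ge0|by rewrite mulr_ge0|by rewrite lerBlDr -lerBlDl|].
      by apply: le_trans Gx; rewrite ler_piMl.
    by clear; lra.
  have [Fz|Fnz] := eqVneq (`|u x| * G (enorm x)) 0.
    rewrite Fz; have : 0 <= sabs dl (u x) * (cutoff N (enorm x) * G (enorm x)).
      by rewrite !mulr_ge0 // sabs_ge0.
    move=> h; rewrite addr_ge0 // addr_ge0 // mulr_ge0 //.
  have xa i : `|x ord0 i| <= a.
    rewrite leNgt; apply/negP => /ltW /Fa h; by rewrite h eqxx in Fnz.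
  have ba1 := tent_at_ge1 a0 xa.
  have kb : k <= k * tent_at a x by rewrite ler_peMr.
  have [[i bi]|no] := pselect (exists i, b <= `|x ord0 i|).
    have bx : b <= enorm x by apply: le_trans bi (coord_le_enorm _ _).
    have : (`|u x| * G (enorm x)) * qq (enorm x) ^+ N <= MF * qq b ^+ N.
      apply: ler_pM => //; first exact: exprn_ge0.
      apply: lerXn2r; rewrite ?nnegrE //.
      rewrite /qq lerB // ler_pM2r ?invr_gt0 ?exprn_gt0 //.
      by apply: lerXn2r; rewrite ?nnegrE // ?enorm_ge0 // ltW.
    have : 0 <= MF * tent_at b x by rewrite mulr_ge0.
    by move: split_ kb; rewrite /k; clear; lra.
  have bb1 : 1 <= tent_at b x.
    apply: tent_at_ge1 => // i; rewrite leNgt; apply/negP => /ltW bi.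
    by apply: no; exists i.
  have : (`|u x| * G (enorm x)) * qq (enorm x) ^+ N <= MF * 1.
    by apply: ler_pM => //; [exact: exprn_ge0 | rewrite exprn_ile1].
  have : MF * 1 <= MF * tent_at b x by rewrite ler_wpM2l.
  have : 0 <= MF * qq b ^+ N by rewrite mulr_ge0.
  by move: split_ kb; rewrite /k; clear; lra.
have t1 : MF * qq b ^+ N * (a ^+ n * B) <= e / 3.
  rewrite ler_pdivlMr // in qN.
  apply: le_trans qN; rewrite mulrAC mulrC ler_wpM2l //.
  by rewrite /Q; clear; lra.
have t2 : dl * MG * (a ^+ n * B) <= e / 3.
  rewrite -mulrA /dl -[leRHS](divfK (lt0r_neq0 P0)); apply: ler_wpM2l; first by rewrite ltW.
  by rewrite /P; clear; lra.
by apply: (le_trans main); rewrite /k mulrDl; move: h1 eb t1 t2; clear; lra.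
Qed.

End field.

(** * The explicit profile *)

Section profile.
Variable R : realType.

Lemma cc_sum n (I : Type) (s : seq I) (c : I -> R) (f : I -> 'rV[R]_n -> R) :
  (forall i, cc (f i)) -> cc (fun x => \sum_(i <- s) c i * f i x).
Proof.
move=> cf; elim: s => [|i s IH].
  by rewrite (_ : (fun x => _) = (fun=> 0)); [exact: cc0 | apply/funext => x; rewrite big_nil].
rewrite (_ : (fun x => _) = (fun x => c i * f i x + \sum_(i <- s) c i * f i x)).
  exact: cc_lin.
by apply/funext => x; rewrite big_cons.
Qed.

Lemma Lam_sum n (I : Type) (s : seq I) (c : I -> R) (f : I -> 'rV[R]_n -> R) :
  (forall i, cc (f i)) ->
  Lam (fun x => \sum_(i <- s) c i * f i x) = \sum_(i <- s) c i * Lam (f i).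
Proof.
move=> cf; elim: s => [|i s IH].
  rewrite big_nil -[RHS](@Lam0 R n); congr Lam; apply/funext => x; by rewrite big_nil.
rewrite big_cons -IH -Lam_lin //; last exact: cc_sum.
by congr Lam; apply/funext => x; rewrite big_cons.
Qed.

Lemma powR_continuous (a d : R) : 0 < d -> {for d, continuous (fun d => d `^ a)}.
Proof.
move=> d0; apply: differentiable_continuous; apply/derivable1_diffP.
by have [] := is_derive1_powR a d0.
Qed.

Lemma powR_npos_le (a d e : R) : a <= 0 -> 0 < d -> d <= e -> e `^ a <= d `^ a.
Proof.
move=> a0 d0 de; have e0 := lt_le_trans d0 de.
rewrite -[a]opprK !(powRN _ (- a)) lef_pV2 ?posrE ?powR_gt0 //.
by apply: ge0_ler_powR; rewrite ?nnegrE ?oppr_ge0 // ltW.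
Qed.

Lemma powR_invl (x a : R) : 0 <= x -> (x^-1) `^ a = x `^ (- a).
Proof. by move=> x0; rewrite -powR_inv1 // -powRrM mulN1r. Qed.

Lemma powR_addn (d a : R) k : 0 < d -> d `^ (k%:R + a) = d ^+ k * d `^ a.
Proof.
by move=> d0; rewrite powRD ?(gt_eqF d0) ?implybT // powR_mulrn // ltW.
Qed.

Variable R0 : R.
Hypothesis R0p : 0 < R0.

(* [LL d = 1 / X (d / R0)]. *)
Definition LL (d : R) := 1 - ln (d / R0).

Lemma LL_ge1 d : 0 < d <= R0 -> 1 <= LL d.
Proof.
move=> /andP[d0 dR]; rewrite /LL lerBrDr -lerBrDl subrr ln_le0 //.
by rewrite ler_pdivrMr // mul1r.
Qed.

Lemma Xf_LL d : Xf (d / R0) = (LL d)^-1. Proof. by []. Qed.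

Lemma is_derive_LL (d : R) : 0 < d -> is_derive d 1 LL (- d^-1).
Proof.
move=> d0; have h1 : is_derive d 1 (fun d => d / R0) R0^-1.
  by apply: is_derive_eq; rewrite /GRing.scale /=; ring.
have h2 := @is_derive1_comp R (@ln R) (fun d => d / R0) d _ _ (is_derive1_ln (divr_gt0 d0 R0p)) h1.
have h3 := is_deriveB (is_derive_cst (1 : R) d (1 : R)) h2.
apply: (is_derive_eq h3); field; by rewrite !gt_eqF.
Qed.

Lemma LL_continuous d : 0 < d -> {for d, continuous LL}.
Proof.
move=> d0; apply: differentiable_continuous; apply/derivable1_diffP.
by have [] := is_derive_LL d0.
Qed.

Lemma LLpow_continuous (a d : R) : 0 < d <= R0 -> {for d, continuous (fun d => LL d `^ a)}.
Proof.
move=> dR; have L1 := LL_ge1 dR; case/andP: dR => d0 _.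
apply: (@continuous_comp _ _ _ LL (fun t => t `^ a)); first exact: LL_continuous.
by apply: powR_continuous; lra.
Qed.

Lemma telescope_pow (d s : R) K : 0 < d ->
  (R0 - d) * \sum_(1 <= k < K.+1) (R0 ^+ k)^-1 * d `^ (k%:R - s) =
  d `^ (1 - s) - d `^ (K%:R + 1 - s) / R0 ^+ K.
Proof.
move=> d0; elim: K => [|K IH].
  by rewrite big_geq // mulr0 add0r expr0 divr1 subrr.
rewrite big_nat_recr //= mulrDr IH.
have -> : d `^ (K%:R + 1 - s) = d `^ (K.+1%:R - s) by rewrite -natr1.
have -> : d `^ (K.+1%:R + 1 - s) = d * d `^ (K.+1%:R - s).
  by rewrite [K.+1%:R + 1]addrC -addrA (powR_addn _ 1 d0).
rewrite exprS; field; by rewrite ?expf_neq0 ?gt_eqF.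
Qed.

Variables (n : nat) (s gam : R).
Hypotheses (n0 : (0 < n)%N) (s1 : 1 <= s) (g1 : 1 < gam).

Let phi d := d `^ (1 - s) - R0 `^ (1 - s) * LL d `^ (1 - gam).
Let dphi d := (1 - s) * d `^ (- s) - R0 `^ (1 - s) * ((gam - 1) * (LL d `^ (- gam) / d)).

Lemma profile_nice : nice_profile R0 phi dphi.
Proof.
move=> d dR; have L1 := LL_ge1 dR; have /andP[d0 _] := dR.
have Lp : 0 < LL d by lra.
split.
  have h1 := is_derive1_powR (1 - s) d0.
  have h2 := @is_derive1_comp R (fun t => t `^ (1 - gam)) LL d _ _
    (is_derive1_powR (1 - gam) Lp) (is_derive_LL d0).
  have h3 := is_deriveB h1 (is_deriveZ (R0 `^ (1 - s)) h2).
  apply: (is_derive_eq h3); rewrite /dphi /GRing.scale /=.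
  have -> : 1 - s - 1 = - s by ring.
  have -> : 1 - gam - 1 = - gam by ring.
  ring.
apply: cvgB; apply: cvgMr; first exact: powR_continuous.
apply: cvgMr; apply: cvgM; first exact: LLpow_continuous.
by apply: cvgV; [rewrite gt_eqF | exact: cvg_id].
Qed.

Lemma profile_bounds d : 0 < d <= R0 -> 0 <= phi d <= d `^ (1 - s).
Proof.
have s1' := s1; have g1' := g1.
move=> dR; have L1 := LL_ge1 dR; case/andP: dR => d0 dR.
rewrite lerBlDr lerDl mulr_ge0 ?powR_ge0 // andbT subr_ge0.
apply: (@le_trans _ _ (R0 `^ (1 - s))); last by apply: powR_npos_le => //; lra.
rewrite ler_piMr ?powR_ge0 // -[leRHS](powRr0 (LL d)).
by apply: ler_powR => //; lra.
Qed.

Let GG r := (s - 1) * (R0 - r) `^ (- s) +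
  \sum_(1 <= k < intpart s) (n - 1)%:R / R0 ^+ k * (R0 - r) `^ (k%:R - s) +
  (gam - 1) * R0 `^ (1 - s) * (LL (R0 - r) `^ (- gam) / (R0 - r)).

Lemma intpart_gt0 : (0 < intpart s)%N.
Proof. by rewrite /intpart truncn_gt0. Qed.

Lemma intpart_le : (intpart s)%:R <= s.
Proof. by rewrite /intpart truncn_le //; have := s1; lra. Qed.

Lemma GG_le r : 0 < r < R0 -> GG r <= (n - 1)%:R * phi (R0 - r) / r - dphi (R0 - r).
Proof.
have s1' := s1; have g1' := g1; move=> /andP[r0 rR].
have d0 : 0 < R0 - r by rewrite subr_gt0.
have rd : R0 - (R0 - r) = r by ring.
have dR : 0 < R0 - r <= R0 by rewrite d0 /=; lra.
have L1 := LL_ge1 dR.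
have ip := prednK intpart_gt0.
have T := telescope_pow s (intpart s).-1 d0.
rewrite rd ip in T.
have key : R0 `^ (1 - s) <= (R0 - r) `^ ((intpart s).-1%:R + 1 - s) / R0 ^+ (intpart s).-1.
  have -> : (intpart s).-1%:R + 1 - s = (intpart s)%:R - s by rewrite natr1 ip.
  rewrite ler_pdivlMr ?exprn_gt0 // mulrC -powR_addn //.
  have -> : (intpart s).-1%:R + (1 - s) = (intpart s)%:R - s by rewrite addrA natr1 ip.
  by apply: powR_npos_le => //; [have := intpart_le; lra | lra].
set S := \sum_(1 <= k < intpart s) (R0 ^+ k)^-1 * (R0 - r) `^ (k%:R - s) in T.
have SE : \sum_(1 <= k < intpart s) (n - 1)%:R / R0 ^+ k * (R0 - r) `^ (k%:R - s) = (n - 1)%:R * S.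
  by rewrite /S mulr_sumr; apply: eq_bigr => k _; rewrite mulrA.
rewrite /GG SE /dphi.
have Sle : S <= phi (R0 - r) / r.
  rewrite ler_pdivlMr // mulrC T /phi lerB //; apply: le_trans key.
  rewrite ler_piMr ?powR_ge0 // -[leRHS](powRr0 (LL (R0 - r))).
  by apply: ler_powR => //; lra.
have : (n - 1)%:R * S <= (n - 1)%:R * (phi (R0 - r) / r) by rewrite ler_wpM2l.
by lra.
Qed.

Lemma pow_dist_continuous (a r : R) : 0 <= r < R0 -> {for r, continuous (fun r => (R0 - r) `^ a)}.
Proof.
move=> /andP[r0 rR]; apply: (@refl_continuous R R0 (fun d => d `^ a) r).
by apply: powR_continuous; lra.
Qed.

Lemma log_dist_continuous (a r : R) : 0 <= r < R0 ->
  {for r, continuous (fun r => LL (R0 - r) `^ a / (R0 - r))}.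
Proof.
move=> /andP[r0 rR]; apply: (@refl_continuous R R0 (fun d => LL d `^ a / d) r).
have d0 : 0 < R0 - r by lra.
apply: cvgM; first by apply: LLpow_continuous; rewrite d0 /=; lra.
by apply: cvgV; [rewrite gt_eqF | exact: cvg_id].
Qed.

Section conversion.
Variables (u : 'rV[R]_n -> R) (r0 : R).
Hypotheses (r0R : 0 <= r0 < R0) (tu : tame r0 u).

Let r0lt : r0 < R0. Proof. by case/andP: r0R. Qed.

Lemma tame_norm_continuous : continuous (fun x => `|u x|).
Proof.
have [du _ _] := tu => x; apply: (@continuous_comp _ _ _ u (fun t => `|t|)).
  exact: differentiable_continuous.
exact: norm_continuous.
Qed.

Lemma tame_norm0 x : r0 <= enorm x -> `|u x| = 0.
Proof. by have [_ _ h] := tu => /h[-> _]; rewrite normr0. Qed.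

Lemma cc_pow (a : R) : cc (fun x => `|u x| * (R0 - enorm x) `^ a).
Proof.
apply: (cc_radial (om := fun r => (R0 - r) `^ a) r0lt tame_norm_continuous tame_norm0).
exact: pow_dist_continuous.
Qed.

Lemma cc_log (a : R) : cc (fun x => `|u x| * (LL (R0 - enorm x) `^ a / (R0 - enorm x))).
Proof.
apply: (cc_radial (om := fun r => LL (R0 - r) `^ a / (R0 - r)) r0lt tame_norm_continuous tame_norm0).
exact: log_dist_continuous.
Qed.

Lemma cc_grad (a : R) : cc (fun x => gradnorm u x * (R0 - enorm x) `^ a).
Proof.
have [_ cD _] := tu.
apply: (cc_radial (om := fun r => (R0 - r) `^ a) r0lt (gradnorm_continuous cD) (fun x => @gradnorm_eq0 _ _ _ _ x tu)).
exact: pow_dist_continuous.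
Qed.

Lemma Pow_term_Lam (b : R) : Pow_term R0 b u = Lam (fun x => `|u x| * (R0 - enorm x) `^ (- b)).
Proof.
rewrite -(@intB_Lam _ _ R0); [|exact: cc_pow|].
  by congr (intB R0 _); apply/funext => x; rewrite powRN.
by move=> x xR; rewrite tame_norm0 ?mul0r // (le_trans (ltW r0lt)).
Qed.

Lemma Grad_term_Lam : Grad_term R0 s u = Lam (fun x => gradnorm u x * (R0 - enorm x) `^ (1 - s)).
Proof.
rewrite -(@intB_Lam _ _ R0); [|exact: cc_grad|].
  by congr (intB R0 _); apply/funext => x; rewrite -(opprB s 1) powRN.
by move=> x xR; rewrite (gradnorm_eq0 tu) ?mul0r // (le_trans (ltW r0lt)).
Qed.

Lemma Log_term_Lam (g : R) : Log_term R0 g u =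
  Lam (fun x => `|u x| * (LL (R0 - enorm x) `^ (- g) / (R0 - enorm x))).
Proof.
rewrite -(@intB_Lam _ _ R0); [|exact: cc_log|].
  congr (intB R0 _); apply/funext => x; rewrite /dist_bd.
  have [xR|Rx] := ltP (enorm x) R0; last first.
    by rewrite tame_norm0 ?mul0r // (le_trans (ltW r0lt)).
  have dR : 0 < R0 - enorm x <= R0 by rewrite subr_gt0 xR /=; have := enorm_ge0 x; lra.
  rewrite Xf_LL powR_invl; last by have := LL_ge1 dR; lra.
  by ring.
by move=> x xR; rewrite tame_norm0 ?mul0r // (le_trans (ltW r0lt)).
Qed.

Lemma hardy_ineq_tame :
  (s - 1) * Pow_term R0 s u
  + \sum_(1 <= k < intpart s) ((n - 1)%:R / R0 ^+ k) * Pow_term R0 (s - k%:R) u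
  + (gam - 1) / R0 `^ (s - 1) * Log_term R0 gam u <= Grad_term R0 s u.
Proof.
have s1' := s1; have g1' := g1.
have dd r : 0 <= r < R0 -> 0 < R0 - r <= R0.
  by move=> /andP[r1 r2]; rewrite subr_gt0 r2 /= lerBlDr lerDl.
rewrite Grad_term_Lam Log_term_Lam Pow_term_Lam.
under eq_bigr do rewrite Pow_term_Lam opprB.
rewrite -Lam_sum; last by move=> k; exact: cc_pow.
have -> : (gam - 1) / R0 `^ (s - 1) = (gam - 1) * R0 `^ (1 - s) by rewrite -powRN opprB.
rewrite -Lam_lin; [|exact: cc_pow|by apply: cc_sum => k; exact: cc_pow].
rewrite addrC -Lam_lin; [|exact: cc_log|].
2: by apply: cc_lin; [exact: cc_pow|by apply: cc_sum => k; exact: cc_pow].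
rewrite [leLHS](_ : _ = Lam (fun x => `|u x| * GG (enorm x))); last first.
  congr Lam; apply/funext => x; rewrite /GG !mulrDr mulr_sumr addrC.
  congr (_ + _ + _); [ring | | ring].
  by apply: eq_bigr => k _; ring.
apply: (hardy_field R0p n0 r0R tu profile_nice profile_bounds (G := GG)).
- by move=> d /andP[d0 _]; exact: powR_continuous.
- move=> r rR; apply: cvgD; first apply: cvgD.
  + by apply: cvgMr; exact: pow_dist_continuous.
  + apply: continuous_at_sum => k; apply: cvgMr; exact: pow_dist_continuous.
  + by apply: cvgMr; exact: log_dist_continuous.
- move=> r rR; have := dd _ rR; move=> dR; have L1 := LL_ge1 dR.
  have d0 : 0 <= R0 - r by case/andP: dR => /ltW.
  have g0 : 0 <= gam - 1 by rewrite subr_ge0 ltW.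
  have s0 : 0 <= s - 1 by rewrite subr_ge0.
  apply: addr_ge0; first apply: addr_ge0.
  + by apply: mulr_ge0 => //; exact: powR_ge0.
  + apply: sumr_ge0 => k _; apply: mulr_ge0; last exact: powR_ge0.
    by apply: divr_ge0 => //; apply: exprn_ge0; exact: ltW.
  + apply: mulr_ge0; first by apply: mulr_ge0 => //; exact: powR_ge0.
    by apply: divr_ge0 => //; exact: powR_ge0.
- exact: GG_le.
Qed.

End conversion.
End profile.

(** * Smooth radial test functions *)

Section test_functions.
Variable R : realType.

(* The family is stable under derivation, which is why the powers of [t^-1] are there. *)
Definition flat k (t : R) : R := if 0 < t then t^-1 ^+ k * expR (- t^-1) else 0.

Lemma flat_pos k t : 0 < t -> flat k t = t^-1 ^+ k * expR (- t^-1).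
Proof. by rewrite /flat => ->. Qed.

Lemma flat_neg k t : t <= 0 -> flat k t = 0.
Proof. by rewrite /flat leNgt => /negbTE ->. Qed.

Lemma flat_ge0 k t : 0 <= flat k t.
Proof.
have [t0|t0] := ltP 0 t; last by rewrite flat_neg.
by rewrite flat_pos // mulr_ge0 ?expR_ge0 // exprn_ge0 // invr_ge0 ltW.
Qed.

Lemma flatS k t : flat k t = t * flat k.+1 t.
Proof.
have [t0|t0] := ltP 0 t; last by rewrite !flat_neg // mulr0.
by rewrite !flat_pos // exprS !mulrA divff ?gt_eqF // mul1r.
Qed.

Lemma flat_le k t : `|flat k t| <= k.+1`!%:R * `|t|.
Proof.
rewrite ger0_norm ?flat_ge0 //.
have [t0|t0] := ltP 0 t; last by rewrite flat_neg // mulr_ge0.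
rewrite flat_pos // gtr0_norm // expRN ler_pdivrMr ?expR_gt0 //.
have y0 : 0 <= t^-1 by rewrite invr_ge0 ltW.
have := expR_ge1Dxn k y0 => h.
have {}h : t^-1 ^+ k.+1 / (k.+1)`!%:R <= expR t^-1 by lra.
rewrite ler_pdivrMr ?ltr0n ?fact_gt0 // exprS ler_pdivrMl // in h.
by apply: (le_trans h); rewrite le_eqVlt; apply/orP; left; apply/eqP; ring.
Qed.

Lemma flat_continuous0 k : {for 0, continuous (flat k)}.
Proof.
rewrite /prop_for /continuous_at [flat k 0]flat_neg //.
apply/(@cvgr0Pnorm_le _ _ _ (nbhs (0 : R))) => e e0.
have c0 : 0 < (k.+1)`!%:R :> R by rewrite ltr0n fact_gt0.
near=> t; apply: (le_trans (flat_le k t)).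
rewrite mulrC -ler_pdivlMr //; near: t.
have := @cvgr0_norm_le R R R (nbhs (0:R)) _ id; apply; last exact: divr_gt0.
exact: cvg_id.
Unshelve. all: by end_near. Qed.

Lemma is_derive_flat k (t : R) :
  is_derive t 1 (flat k) (flat k.+2 t - k%:R * flat k.+1 t).
Proof.
have [t0|t0|/esym ->] := ltgtP 0 t.
- have h1 : is_derive t 1 (fun t : R => t^-1) (- t ^- 2).
    have := is_deriveV (lt0r_neq0 t0 : id t != 0) (is_derive_id t (1 : R)).
    by rewrite /GRing.scale /= mulr1.
  have h2 := @is_deriveX _ _ (fun t : R => t^-1) k t 1 _ h1.
  have h3 := @is_derive1_comp R (@expR R) (fun t => - t^-1) t _ _ (is_derive_expR _) (is_deriveN h1).
  have h4 := is_deriveM h2 h3.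
  apply: near_eq_is_derive (is_derive_eq h4 _).
    near=> y; rewrite flat_pos; last by near: y; exact: lt_nbhsr.
    by rewrite [LHS]/= exprfctE.
  rewrite !flat_pos // /GRing.scale /= exprfctE opprK !exprS.
  case: k {h2 h4} => [|k]; first by rewrite !mul0r expr0 /=; field; rewrite gt_eqF.
  by rewrite /= exprS; field; rewrite gt_eqF.
- rewrite !flat_neg ?ltW // mulr0 subr0.
  apply: near_eq_is_derive (is_derive_cst (0 : R) t (1 : R)).
  near=> y; rewrite flat_neg // ltW //; near: y; exact: lt_nbhsl.
rewrite !flat_neg // mulr0 subr0.
apply/is_derive1_caratheodory; exists (flat k.+1); split.
- by move=> z; rewrite [flat k 0]flat_neg // !subr0 flatS mulrC.
- exact: flat_continuous0.
- by rewrite flat_neg.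
Unshelve. all: by end_near. Qed.

Lemma flat2_le t : 0 < t -> flat 2 t <= t^-1 ^+ 2.
Proof.
move=> t0; rewrite flat_pos // ler_piMr ?exprn_ge0 ?invr_ge0 ?ltW //.
by rewrite expR_lt1 oppr_lt0 invr_gt0.
Qed.

Lemma flat0_le1 t : flat 0 t <= 1.
Proof.
have [t0|t0] := ltP 0 t; last by rewrite flat_neg.
by rewrite flat_pos // expr0 mul1r expR_le1 oppr_le0 invr_ge0 ltW.
Qed.

Lemma flat0_homo : {homo flat 0 : t s / t <= s}.
Proof.
move=> t s ts; have [t0|t0] := ltP 0 t; last by rewrite flat_neg // flat_ge0.
have s0 := lt_le_trans t0 ts.
by rewrite !flat_pos // !expr0 !mul1r ler_expR lerN2 lef_pV2.
Qed.

Variable n : nat.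
Implicit Types f g : 'rV[R]_n -> R.

(* An algebra of functions stable under directional derivatives, hence made of smooth functions. *)
Inductive flat_algebra : ('rV[R]_n -> R) -> Prop :=
| flat_cst c : flat_algebra (fun=> c)
| flat_coord i : flat_algebra (fun x => x ord0 i)
| flat_add f g : flat_algebra f -> flat_algebra g -> flat_algebra (fun x => f x + g x)
| flat_mul f g : flat_algebra f -> flat_algebra g -> flat_algebra (fun x => f x * g x)
| flat_comp k f : flat_algebra f -> flat_algebra (fun x => flat k (f x)).

Lemma differentiable_flat k (t : R) : differentiable (flat k) t.
Proof. by apply/derivable1_diffP; have [] := is_derive_flat k t. Qed.

Lemma diff_flat k (t h : R) : 'd (flat k) t h = h * (flat k.+2 t - k%:R * flat k.+1 t).
Proof.
have [d1 E] := is_derive_flat k t.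
by rewrite diff1E ?derive1E ?E //; exact: differentiable_flat.
Qed.

Lemma flat_algebra_diff f : flat_algebra f -> (forall x, differentiable f x) /\
  forall v, flat_algebra ('D_v f).
Proof.
elim=> {f} [c|i|f g _ [df Df] _ [dg Dg]|f g cf [df Df] cg [dg Dg]|k f cf [df Df]].
- split=> [x|v]; first exact: differentiable_cst.
  rewrite (_ : 'D_v _ = fun=> 0); first exact: flat_cst.
  by apply/funext => x; rewrite derive_cst.
- have dc x : differentiable (fun x : 'rV[R]_n => x ord0 i) x by exact: differentiable_coord.
  split=> // v; rewrite (_ : 'D_v _ = fun=> v ord0 i); first exact: flat_cst.
  apply/funext => x; rewrite /derive.
  apply: cvg_lim => //; apply: cvg_near_cst; near=> h.
  rewrite /= !mxE addrK /GRing.scale /= mulKf //.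
  by near: h; exact: nbhs_dnbhs_neq.
- have dfg x : differentiable (fun x => f x + g x) x by exact: (differentiableD (df x) (dg x)).
  split=> // v; rewrite (_ : 'D_v _ = fun x => 'D_v f x + 'D_v g x); first exact: flat_add.
  by apply/funext => x; rewrite -deriveD //; exact: diff_derivable.
- have dfg x : differentiable (fun x => f x * g x) x by exact: (differentiableM (df x) (dg x)).
  split=> // v; rewrite (_ : 'D_v _ = fun x => f x * 'D_v g x + g x * 'D_v f x).
    by apply: flat_add; apply: flat_mul.
  by apply/funext => x; rewrite -[RHS]deriveM //; exact: diff_derivable.
have dk x : differentiable (flat k \o f) x.
  by apply: differentiable_comp => //; exact: differentiable_flat.
split=> // v; rewrite (_ : 'D_v _ = fun x => 'D_v f x * (flat k.+2 (f x) + (- k%:R) * flat k.+1 (f x))).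
  apply: flat_mul => //; apply: flat_add; first exact: flat_comp.
  by apply: flat_mul; [exact: flat_cst | exact: flat_comp].
apply/funext => x; rewrite -[LHS]/('D_v (flat k \o f) x) deriveE // diff_comp //=; last exact: differentiable_flat.
by rewrite diff_flat deriveE // mulNr.
Unshelve. all: by end_near. Qed.

Lemma flat_algebra_smooth f : flat_algebra f -> smooth f.
Proof.
move=> cf vs x; have : flat_algebra (iter_dir vs f).
  by elim: vs => [//|v vs IH] /=; have [_] := flat_algebra_diff IH; exact.
by move=> /flat_algebra_diff[].
Qed.

Lemma flat_algebra_enorm2 : flat_algebra (fun x => enorm x ^+ 2).
Proof.
under eq_fun do rewrite enorm_sq.
elim: (index_enum _) => [|i s IH].
  by under eq_fun do rewrite big_nil; exact: flat_cst.
under eq_fun do rewrite big_cons.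
by apply: flat_add => //; apply: flat_mul; exact: flat_coord.
Qed.

Definition test (rho tau : R) (x : 'rV[R]_n) : R :=
  flat 0 ((rho ^+ 2 - enorm x ^+ 2) / tau).

Lemma test_algebra rho tau : flat_algebra (test rho tau).
Proof.
apply: flat_comp; apply: (@flat_mul (fun x => rho ^+ 2 - enorm x ^+ 2) (fun=> tau^-1)).
  apply: (@flat_add (fun=> rho ^+ 2) (fun x => - enorm x ^+ 2)); first exact: flat_cst.
  under eq_fun do rewrite -mulN1r.
  by apply: flat_mul; [exact: flat_cst | exact: flat_algebra_enorm2].
exact: flat_cst.
Qed.

Lemma test_Cc rho tau R0 : 0 <= rho < R0 -> 0 < tau -> Cc_ball R0 (test rho tau).
Proof.
move=> rR t0; split; first exact/flat_algebra_smooth/test_algebra.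
exists rho; split => // x rx; rewrite /test flat_neg // pmulr_lle0 ?invr_gt0 //.
by rewrite subr_le0; apply: lerXn2r; rewrite ?nnegrE ?enorm_ge0 //; case/andP: rR.
Qed.

Lemma derive_enorm2 (x v : 'rV[R]_n) :
  'D_v (fun x => enorm x ^+ 2) x = 2 * \sum_(i < n) x ord0 i * v ord0 i.
Proof.
rewrite (_ : (fun x => _) = \sum_(i < n) (fun x : 'rV[R]_n => x ord0 i) ^+ 2); last first.
  by apply/funext => y; rewrite enorm_sq fct_sumE; apply: eq_bigr => i _; rewrite exprfctE.
have dc i : is_derive x v (fun x : 'rV[R]_n => x ord0 i) (v ord0 i).
  have [h _] := flat_algebra_diff (flat_coord i).
  apply: DeriveDef; first exact: diff_derivable.
  apply: cvg_lim => //; apply: cvg_near_cst; near=> h'.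
  rewrite /= !mxE addrK /GRing.scale /= mulKf //.
  by near: h'; exact: nbhs_dnbhs_neq.
have h := is_derive_sum (fun i => @is_deriveX _ _ _ 2 x v _ (dc i)).
have [_ ->] := h; rewrite mulr_sumr; apply: eq_bigr => i _.
rewrite /GRing.scale /= expr1; ring.
Unshelve. all: by end_near. Qed.

Lemma derive_test rho tau (x v : 'rV[R]_n) :
  'D_v (test rho tau) x =
  - (2 / tau) * flat 2 ((rho ^+ 2 - enorm x ^+ 2) / tau) * \sum_(i < n) x ord0 i * v ord0 i.
Proof.
pose q (x : 'rV[R]_n) := (rho ^+ 2 - enorm x ^+ 2) / tau.
have [de _] := flat_algebra_diff flat_algebra_enorm2.
have h1 : is_derive x v (fun x => enorm x ^+ 2) (2 * \sum_(i < n) x ord0 i * v ord0 i).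
  by rewrite -derive_enorm2; apply: derivableP; exact: diff_derivable.
have h2 := is_deriveB (is_derive_cst (rho ^+ 2) x v) h1.
have h3 := is_deriveZ tau^-1 h2.
have qE : q = tau^-1 \*: (cst (rho ^+ 2) - (fun x => enorm x ^+ 2)).
  by apply/funext => y; rewrite /q mulrC.
rewrite -qE in h3; have [dq Dq] := h3.
have dq' : differentiable q x.
  by rewrite qE; apply: differentiableZ; apply: differentiableB.
rewrite -[LHS]/('D_v (flat 0 \o q) x) deriveE; last first.
  by apply: differentiable_comp => //; exact: differentiable_flat.
rewrite diff_comp //=; last exact: differentiable_flat.
rewrite diff_flat -deriveE // Dq /q /GRing.scale /=; ring.
Qed.

Lemma gradnorm_test rho tau (x : 'rV[R]_n) : 0 < tau ->
  gradnorm (test rho tau) x =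
  2 / tau * flat 2 ((rho ^+ 2 - enorm x ^+ 2) / tau) * enorm x.
Proof.
move=> t0; set c := 2 / tau * _.
have c0 : 0 <= c by rewrite mulr_ge0 ?flat_ge0 // divr_ge0 // ltW.
rewrite /gradnorm (_ : \sum_(i < n) _ = c ^+ 2 * enorm x ^+ 2).
  by rewrite sqrtrM ?sqr_ge0 // !sqrtr_sqr !ger0_norm // enorm_ge0.
rewrite enorm_sq mulr_sumr; apply: eq_bigr => i _; rewrite derive_test.
rewrite (bigD1 i) //= big1 ?addr0.
  by rewrite mxE !eqxx mulr1 /c; ring.
by move=> j ji; rewrite mxE (negbTE ji) andbF mulr0.
Qed.

Lemma derive_radial_test rho tau (x : 'rV[R]_n) : 0 < tau ->
  - 'D_x (test rho tau) x = enorm x * gradnorm (test rho tau) x.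
Proof.
move=> t0; rewrite derive_test gradnorm_test //.
have -> : \sum_(i < n) x ord0 i * x ord0 i = enorm x ^+ 2.
  by rewrite enorm_sq; apply: eq_bigr => i _; rewrite expr2.
ring.
Qed.

Lemma gradnorm_test_le rho rho' tau (x : 'rV[R]_n) : 0 < tau -> 0 <= rho' < rho ->
  enorm x <= rho' ->
  gradnorm (test rho tau) x <= 2 * tau / (rho ^+ 2 - rho' ^+ 2) ^+ 2 * enorm x.
Proof.
move=> t0 /andP[r0 r1] xr; rewrite gradnorm_test // ler_wpM2r ?enorm_ge0 //.
have d0 : 0 < rho ^+ 2 - rho' ^+ 2 by rewrite subr_gt0 ltrXn2r // nnegrE // ltW // (le_lt_trans r0).
have dx : rho ^+ 2 - rho' ^+ 2 <= rho ^+ 2 - enorm x ^+ 2.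
  by rewrite lerD2l lerN2; apply: lerXn2r; rewrite ?nnegrE ?enorm_ge0.
set D := rho ^+ 2 - rho' ^+ 2 in d0 dx *; set E := rho ^+ 2 - _ in dx *.
have E0 : 0 < E := lt_le_trans d0 dx.
apply: (@le_trans _ _ (2 / tau * (E / tau)^-1 ^+ 2)).
  by rewrite ler_wpM2l ?divr_ge0 ?(ltW t0) // flat2_le // divr_gt0.
have -> : 2 / tau * (E / tau)^-1 ^+ 2 = 2 * tau / E ^+ 2.
  by field; rewrite !gt_eqF.
rewrite ler_wpM2l ?mulr_ge0 ?(ltW t0) // lef_pV2 ?posrE ?exprn_gt0 //.
by apply: lerXn2r; rewrite ?nnegrE ?(ltW d0) ?(ltW E0).
Qed.

End test_functions.

(** * Divergence of the critical logarithmic integral *)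

Section test_family.
Variables (R : realType) (n : nat) (R0 : R).
Hypothesis R0p : 0 < R0.
Hypothesis n0 : (0 < n)%N.

Notation u := (@test R n).
Notation tent0 := (@tent_at R n R0).

Definition admissible (rho tau : R) := 3 / 4 * R0 <= rho < R0 /\ 0 < tau <= 1.

Lemma admissible_Cc rho tau : admissible rho tau -> Cc_ball R0 (u rho tau).
Proof.
have R0p' := R0p; move=> [/andP[h1 h2] /andP[h3 _]]; apply: test_Cc => //.
by rewrite h2 andbT; lra.
Qed.

Lemma test_ge0 rho tau x : 0 <= u rho tau x.
Proof. exact: flat_ge0. Qed.

Lemma test_abs rho tau x : `|u rho tau x| = u rho tau x.
Proof. by rewrite ger0_norm // test_ge0. Qed.

Section fixed.
Variables rho tau : R.
Hypothesis adm : admissible rho tau.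

Lemma admissible_tame : exists2 r0, 0 <= r0 < R0 & tame r0 (u rho tau).
Proof. exact/Cc_tame/admissible_Cc. Qed.

Lemma test_tau0 : 0 < tau. Proof. by case: adm => _ /andP[]. Qed.

Lemma cc_test_radial (om : R -> R) : (forall r, 0 <= r < R0 -> {for r, continuous om}) ->
  cc (fun x => u rho tau x * om (enorm x)).
Proof.
move=> com; have [r0 /andP[_ r0R] [du _ u0]] := admissible_tame.
apply: (cc_radial r0R _ _ com); last by move=> x /u0[].
by move=> x; exact: differentiable_continuous.
Qed.

Lemma cc_test_derive_radial (om : R -> R) : (forall r, 0 <= r < R0 -> {for r, continuous om}) ->
  cc (fun x => - 'D_x (u rho tau) x * om (enorm x)).
Proof.
move=> com; have [r0 /andP[_ r0R] [du cD u0]] := admissible_tame.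
apply: (cc_radial r0R _ _ com); last by move=> x /u0[_ ->]; rewrite oppr0.
move=> x; apply: (@continuousN _ _ _ (fun x => 'D_x (u rho tau) x) x).
exact: derive_diag_continuous.
Qed.

Lemma cc_test : cc (u rho tau).
Proof.
have h r : 0 <= r < R0 -> {for r, continuous (fun=> 1 : R)} by move=> _; exact: cvg_cst.
have := cc_test_radial h.
by under eq_fun do rewrite mulr1.
Qed.

Lemma test_euler (psi kap : R -> R) : kap 0 = 0 ->
  (forall r, 0 < r < R0 -> is_derive r 1 psi (kap r / r)) ->
  (forall r, 0 <= r < R0 -> {for r, continuous psi}) ->
  (forall r, 0 <= r < R0 -> {for r, continuous kap}) ->
  Lam (fun x => - 'D_x (u rho tau) x * psi (enorm x)) =
  Lam (fun x => u rho tau x * (n%:R * psi (enorm x) + kap (enorm x))).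
Proof.
have [r0 /andP[_ r0R] [du cD u0]] := admissible_tame.
apply: (euler_radial r0R).
- by move=> x; exact: differentiable_continuous.
- exact: derive_diag_continuous.
- by move=> x /u0[].
- by move=> x /u0[_]; exact.
- exact: rad_derive_diff.
Qed.

Lemma cc_test_derive : cc (fun x => - 'D_x (u rho tau) x).
Proof.
have h r : 0 <= r < R0 -> {for r, continuous (fun=> 1 : R)} by move=> _; exact: cvg_cst.
have := cc_test_derive_radial h.
by under eq_fun do rewrite mulr1.
Qed.

Lemma Lam_test_derive : Lam (fun x => - 'D_x (u rho tau) x) = n%:R * Lam (u rho tau).
Proof.
rewrite -LamZ; last exact: cc_test.
transitivity (Lam (fun x => - 'D_x (u rho tau) x * 1)).
  by congr Lam; apply/funext => x; rewrite mulr1.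
apply: (etrans (@test_euler (fun=> 1) (fun=> 0) _ _ _ _)) => //.
- by move=> r _; rewrite mul0r; exact: is_derive_cst.
- by move=> r _; exact: cvg_cst.
- by move=> r _; exact: cvg_cst.
by congr Lam; apply/funext => x; ring.
Qed.

Lemma test_out x : R0 <= enorm x -> u rho tau x = 0.
Proof.
by have [r0 /andP[_ r0R] [_ _ h]] := admissible_tame => xR; have [] := h x (le_trans (ltW r0R) xR).
Qed.

Lemma test_derive_out x : R0 <= enorm x -> 'D_x (u rho tau) x = 0.
Proof.
have [r0 /andP[_ r0R] [_ _ h]] := admissible_tame => xR.
by have [_ ->] := h x (le_trans (ltW r0R) xR).
Qed.

Lemma test_derive_ge0 x : 0 <= - 'D_x (u rho tau) x.
Proof. by rewrite derive_radial_test ?test_tau0 // mulr_ge0 ?enorm_ge0 ?gradnorm_ge0. Qed.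

Lemma tent0_ge1 (x : 'rV[R]_n) : enorm x <= R0 -> 1 <= tent0 x.
Proof. by move=> xR; apply: tent_at_ge1 => // i; apply: le_trans xR; exact: coord_le_enorm. Qed.

Lemma Lam_test_le : Lam (u rho tau) <= Lam tent0.
Proof.
apply: Lam_le; [exact: cc_test|exact: tent_at_cc|move=> x].
have [xR|Rx] := ltP (enorm x) R0; last by rewrite test_out // tent_at_ge0.
by apply: le_trans (flat0_le1 _) (tent0_ge1 (ltW xR)).
Qed.

Lemma Lam_test_ge : Lam (u (R0 / 2) 1) <= Lam (u rho tau).
Proof.
have R0p' := R0p; have [/andP[h1 h2] /andP[h3 h4]] := adm.
have hc : Cc_ball R0 (u (R0 / 2) 1) by apply: test_Cc => //; apply/andP; split; lra.
have [r0 /andP[_ r0R] [du _ u0]] := Cc_tame hc.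
apply: Lam_le; [|exact: cc_test|].
  apply: (@cc_continuous_enorm _ _ _ r0); last by move=> x /u0[].
  by move=> x; exact: differentiable_continuous.
move=> x; rewrite /test.
set A := (R0 / 2) ^+ 2 - enorm x ^+ 2; set B := rho ^+ 2 - enorm x ^+ 2.
have AB : A <= B.
  by rewrite lerD2r; apply: lerXn2r; rewrite ?nnegrE; lra.
have [A0|A0] := ltP 0 (A / 1); last by rewrite (flat_neg 0 A0) flat_ge0.
apply: flat0_homo; rewrite divr1 in A0 *; rewrite ler_pdivlMr //.
by apply: le_trans AB; rewrite ler_piMr // ltW.
Qed.

End fixed.

Lemma Lam_test0_gt0 : 0 < Lam (u (R0 / 2) 1).
Proof.
have R0p' := R0p.
have hc : Cc_ball R0 (u (R0 / 2) 1) by apply: test_Cc => //; apply/andP; split; lra.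
have [r0 /andP[_ r0R] [du _ u0]] := Cc_tame hc.
apply: (@Lam_gt0 _ _ _ 0).
- apply: (@cc_continuous_enorm _ _ _ r0); last by move=> x /u0[].
  by move=> x; exact: differentiable_continuous.
- by move=> x; exact: test_ge0.
have -> : u (R0 / 2) 1 0 = flat 0 ((R0 / 2) ^+ 2).
  by rewrite /test -(scale0r (0 : 'rV[R]_n)) enormZ normr0 mul0r expr0n subr0 divr1.
by rewrite flat_pos ?exprn_gt0 ?divr_gt0 // expr0 mul1r expR_gt0.
Qed.

Definition W0 (d : R) := LL R0 d `^ (- 1) / d.

Lemma W0_cont r : 0 <= r < R0 -> {for r, continuous (fun r => W0 (R0 - r))}.
Proof. exact: log_dist_continuous. Qed.

Lemma dist_itv (r : R) : 0 <= r < R0 -> 0 < R0 - r <= R0.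
Proof. by move=> /andP[r1 r2]; rewrite subr_gt0 r2 /= lerBlDr lerDl. Qed.

Lemma loglog_bound (d : R) : 0 < d <= R0 -> LL R0 d - 1 <= 4 * R0 * W0 d.
Proof.
move=> dR; have L1 := LL_ge1 R0p dR; have /andP[d0 _] := dR.
set y := LL R0 d - 1.
have y0 : 0 <= y by rewrite /y; lra.
have dE : d / R0 = expR (- y).
  by rewrite /y /LL opprB opprB addrCA subrr addr0 lnK // posrE divr_gt0.
have LE : LL R0 d = 1 + y by rewrite /y; ring.
have e1 : (1 + y / 2) ^+ 2 <= expR y.
  have -> : expR y = expR (y / 2) ^+ 2 by rewrite -expRM_natl; congr expR; field.
  apply: lerXn2r; rewrite ?nnegrE ?expR_ge0 ?expR_ge1Dx //; lra.
have -> : 4 * R0 * W0 d = 4 * expR y / (1 + y).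
  have Ey : expR y = R0 / d by rewrite -[y]opprK expRN -dE invf_div.
  rewrite /W0 LE powR_inv1; last by lra.
  by rewrite Ey; field; rewrite !gt_eqF //; lra.
rewrite ler_pdivlMr; last by lra.
by rewrite !exprS expr0 in e1; nra.
Qed.

(* Euler's identity with [psi = log log]: the mass [- D_x u] concentrates where [psi] is large. *)
Lemma test_divergence (B : R) : exists rho tau,
  admissible rho tau /\ B <= Lam (fun x => u rho tau x * W0 (R0 - enorm x)).
Proof.
have R0p' := R0p.
pose psi r := ln (LL R0 (R0 - r)).
pose kap r := r * W0 (R0 - r).
have c1 := Lam_test0_gt0; set c := Lam _ in c1.
pose Q : R := (4 * n%:R + 1) * R0.
have Q0 : 0 < Q by rewrite mulr_gt0 // ltr_wpDl // mulr_ge0.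
pose N := (1 + `|B|) * Q * 2 / c.
have N0 : 0 < N by rewrite divr_gt0 // !mulr_gt0 // ltr_pwDl.
pose d' := Num.min (R0 * expR (1 - expR N)) (R0 / 2).
have d'0 : 0 < d' by rewrite lt_min mulr_gt0 ?expR_gt0 //= divr_gt0.
have d'R : d' <= R0 / 2 by rewrite ge_min lexx orbT.
pose rho' := R0 - d'.
pose rho := (rho' + R0) / 2.
have rr : 0 <= rho' < rho by rewrite /rho /rho'; apply/andP; split; lra.
have psi_ge0 r : 0 <= r < R0 -> 0 <= psi r.
  by move=> /dist_itv/(LL_ge1 R0p) h; rewrite ln_ge0.
have psiN r : rho' <= r < R0 -> N <= psi r.
  move=> /andP[h1 h2].
  have d0 : 0 < R0 - r by lra.
  have dd' : R0 - r <= R0 * expR (1 - expR N).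
    by apply: (@le_trans _ _ d'); [rewrite /rho' in h1; lra | rewrite ge_min lexx].
  have h : expR N <= LL R0 (R0 - r).
    rewrite /LL lerBrDr -lerBrDl -[leRHS]expRK ler_ln ?posrE ?expR_gt0 ?divr_gt0 //.
    by rewrite ler_pdivrMr // mulrC.
  rewrite /psi -[leLHS]expRK ler_ln ?posrE ?expR_gt0 //.
  exact: lt_le_trans (expR_gt0 _) h.
have D0 : 0 < rho ^+ 2 - rho' ^+ 2.
  case/andP: rr => h1 h2.
  by rewrite subr_gt0 ltrXn2r // nnegrE // ltW // (le_lt_trans h1).
pose T := Lam tent0.
have T0 : 0 <= T by apply: Lam_ge0 (tent_at_ge0 _); exact: tent_at_cc.
pose K1 := 2 / (rho ^+ 2 - rho' ^+ 2) ^+ 2 * R0 ^+ 2.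
have K10 : 0 < K1 by rewrite !mulr_gt0 ?invr_gt0 ?exprn_gt0.
have KT : 0 < 2 * (1 + K1 * T) by rewrite mulr_gt0 // ltr_pwDl // mulr_ge0 // ltW.
pose tau := Num.min 1 (c / (2 * (1 + K1 * T))).
have tau0 : 0 < tau by rewrite lt_min ltr01 divr_gt0.
have tau1 : tau <= 1 by rewrite ge_min lexx.
have tauK : tau * (K1 * T) <= c / 2.
  have : tau <= c / (2 * (1 + K1 * T)) by rewrite ge_min lexx orbT.
  by rewrite ler_pdivlMr //; lra.
have adm : admissible rho tau.
  by split; [rewrite /rho /rho'; apply/andP; split; lra | rewrite tau0].
exists rho, tau; split => //.
have cpsi r : 0 <= r < R0 -> {for r, continuous psi}.
  move=> rR; have /dist_itv dR := rR; have L1 := LL_ge1 R0p dR; case/andP: dR => d0 _.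
  apply: (@continuous_comp _ _ _ (fun r => LL R0 (R0 - r)) (@ln R)).
    by apply: (@refl_continuous R R0 (LL R0) r); exact: LL_continuous.
  by apply: continuous_ln; lra.
have ckap r : 0 <= r < R0 -> {for r, continuous kap}.
  move=> rR; apply: (@continuous_at_mul R R id (fun r => W0 (R0 - r)) r); first exact: cvg_id.
  exact: W0_cont.
have dpsi r : 0 < r < R0 -> is_derive r 1 psi (kap r / r).
  move=> /andP[r0 rR].
  have dR : 0 < R0 - r <= R0 by apply: dist_itv; rewrite rR ltW.
  have L1 := LL_ge1 R0p dR; case/andP: dR => d0 _.
  have Lp : 0 < LL R0 (R0 - r) by lra.
  have h1 : is_derive r 1 (fun r => R0 - r) (-1) by apply: is_derive_eq; ring.
  have h2 := @is_derive1_comp R (LL R0) (fun r => R0 - r) r _ _ (is_derive_LL R0p d0) h1.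
  have h3 := @is_derive1_comp R (@ln R) (fun r => LL R0 (R0 - r)) r _ _ (is_derive1_ln Lp) h2.
  apply: (is_derive_eq h3); rewrite /kap /W0 powR_inv1; last by lra.
  by field; rewrite !gt_eqF.
have kap0 : kap 0 = 0 by rewrite /kap mul0r.
have E := test_euler adm kap0 dpsi cpsi ckap.
have up : Lam (fun x => u rho tau x * (n%:R * psi (enorm x) + kap (enorm x))) <=
          Q * Lam (fun x => u rho tau x * W0 (R0 - enorm x)).
  have cW : cc (fun x => u rho tau x * W0 (R0 - enorm x)).
    exact: (cc_test_radial adm W0_cont).
  rewrite -LamZ //; apply: Lam_le; last move=> x.
  - apply: (cc_test_radial adm (om := fun r => n%:R * psi r + kap r)) => r rR.
    by apply: cvgD; [apply: cvgMr; exact: cpsi | exact: ckap].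
  - exact: ccZ.
  have [xR|Rx] := ltP (enorm x) R0; last by rewrite (test_out adm) // !mul0r mulr0.
  rewrite mulrCA ler_wpM2l ?test_ge0 //.
  have /dist_itv dR : 0 <= enorm x < R0 by rewrite enorm_ge0.
  have L1 := LL_ge1 R0p dR.
  have W0p : 0 <= W0 (R0 - enorm x).
    by rewrite divr_ge0 ?powR_ge0 //; case/andP: dR => /ltW.
  have h1 : psi (enorm x) <= 4 * R0 * W0 (R0 - enorm x).
    apply: le_trans (loglog_bound dR); rewrite /psi.
    have := @le_ln1Dx R (LL R0 (R0 - enorm x) - 1).
    have -> : 1 + (LL R0 (R0 - enorm x) - 1) = LL R0 (R0 - enorm x) by ring.
    by apply; lra.
  have h2 : kap (enorm x) <= R0 * W0 (R0 - enorm x) by rewrite ler_wpM2r // ltW.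
  have h3 : n%:R * psi (enorm x) <= n%:R * (4 * R0 * W0 (R0 - enorm x)) by rewrite ler_wpM2l.
  by rewrite /Q; lra.
have lo : N * (Lam (fun x => - 'D_x (u rho tau) x) - tau * (K1 * T)) <=
          Lam (fun x => - 'D_x (u rho tau) x * psi (enorm x)).
  have cD := cc_test_derive adm.
  have ct := @tent_at_cc R n R0 R0p.
  rewrite mulrBr mulrA mulrA lerBlDr -lerBlDl.
  have -> : N * Lam (fun x => - 'D_x (u rho tau) x) -
    Lam (fun x => - 'D_x (u rho tau) x * psi (enorm x)) =
    N * Lam (fun x => - 'D_x (u rho tau) x) +
    Lam (fun x => -1 * (- 'D_x (u rho tau) x * psi (enorm x))).
    by rewrite LamZ ?mulN1r //; exact: cc_test_derive_radial.
  have cDp : cc (fun x => -1 * (- 'D_x (u rho tau) x * psi (enorm x))).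
    by apply: ccZ; exact: cc_test_derive_radial.
  rewrite -Lam_lin // -LamZ //; apply: Lam_le; [exact: cc_lin | exact: ccZ | move=> x].
  have := test_derive_ge0 adm x; set D := - 'D_x _ x => D0'.
  have t0 := @tent_at_ge0 R n R0 x.
  have c0 : 0 <= N * tau * K1 by apply: mulr_ge0; [apply: mulr_ge0|]; exact: ltW.
  have [xR|Rx] := ltP (enorm x) R0; last first.
    by rewrite /D (test_derive_out adm) // oppr0 mul0r !mulr0 addr0; apply: mulr_ge0.
  have rR : 0 <= enorm x < R0 by rewrite enorm_ge0.
  have [xr|rx] := leP rho' (enorm x).
    have h : N <= psi (enorm x) by apply: psiN; rewrite xr.
    have : N * D <= psi (enorm x) * D by rewrite ler_wpM2r.
    have : 0 <= N * tau * K1 * tent0 x by rewrite mulr_ge0.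
    by lra.
  have h1 : 0 <= D * psi (enorm x) by rewrite mulr_ge0 // psi_ge0.
  have h2 : D <= tau * K1.
    rewrite /D derive_radial_test //.
    have g := gradnorm_test_le tau0 rr (ltW rx).
    apply: (le_trans (ler_wpM2l (enorm_ge0 x) g)).
    have -> : enorm x * (2 * tau / (rho ^+ 2 - rho' ^+ 2) ^+ 2 * enorm x) =
      tau * (2 / (rho ^+ 2 - rho' ^+ 2) ^+ 2 * enorm x ^+ 2) by ring.
    rewrite ler_wpM2l ?(ltW tau0) // /K1 ler_wpM2l //.
      by rewrite divr_ge0 // exprn_ge0 // ltW.
    by apply: lerXn2r; rewrite ?nnegrE ?enorm_ge0 // ltW.
  have h3 : N * D <= N * (tau * K1) by rewrite ler_wpM2l // ltW.
  have h4 : N * tau * K1 <= N * tau * K1 * tent0 x.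
    by rewrite ler_peMr // tent0_ge1 // ltW.
  by lra.
rewrite E Lam_test_derive // in lo.
have cle : c <= Lam (u rho tau) by exact: Lam_test_ge.
have cn : Lam (u rho tau) <= n%:R * Lam (u rho tau).
  by rewrite ler_peMl ?ler1n //; lra.
have h : N * (c / 2) <= N * (n%:R * Lam (u rho tau) - tau * (K1 * T)).
  by rewrite ler_wpM2l ?(ltW N0) //; lra.
have NE : N * (c / 2) = (1 + `|B|) * Q by rewrite /N; field; rewrite gt_eqF.
have : (1 + `|B|) * Q <= Q * Lam (fun x => u rho tau x * W0 (R0 - enorm x)).
  by rewrite -NE; apply: le_trans h _; apply: le_trans lo up.
rewrite mulrC ler_pM2l // => h'.
by have := ler_norm B; lra.
Qed.

End test_family.

(** * Upper bounds along the test family *)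

Section upper.
Variables (R : realType) (n : nat) (R0 s : R).
Hypothesis R0p : 0 < R0.
Hypothesis n0 : (0 < n)%N.
Hypothesis s1 : 1 <= s.

Notation u := (@test R n).
Notation tent0 := (@tent_at R n R0).

Lemma qq_pow_bound (j : nat) r : s - 1 <= j%:R -> 0 <= r < R0 ->
  qq R0 r ^+ j * (R0 - r) `^ (1 - s) <= (2 / R0) ^+ j * R0 `^ (j%:R + (1 - s)).
Proof.
move=> js rR; have /andP[d0 dR] := dist_itv rR; have /andP[r0 rR'] := rR.
have R0p' := R0p.
have qE : qq R0 r = (R0 - r) * (R0 + r) / R0 ^+ 2 by rewrite /qq; field; rewrite gt_eqF.
have q0 : 0 <= qq R0 r.
  by have /andP[] : 0 <= qq R0 r <= 1 by apply: qq_itv => //; rewrite r0 ltW.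
have qle : qq R0 r <= 2 / R0 * (R0 - r).
  have -> : 2 / R0 * (R0 - r) = (R0 - r) * (2 * R0) / R0 ^+ 2 by field; rewrite gt_eqF.
  rewrite qE ler_pM2r ?invr_gt0 ?exprn_gt0 // ler_pM2l //; lra.
apply: (@le_trans _ _ ((2 / R0 * (R0 - r)) ^+ j * (R0 - r) `^ (1 - s))).
  rewrite ler_wpM2r ?powR_ge0 //; apply: lerXn2r; rewrite ?nnegrE //.
  exact: le_trans q0 qle.
rewrite exprMn -mulrA -powR_addn // ler_wpM2l ?exprn_ge0 ?divr_ge0 ?(ltW R0p) //.
apply: ge0_ler_powR; rewrite ?nnegrE ?(ltW d0) ?(ltW R0p) //.
by lra.
Qed.

Definition profile_gap N m (r : R) := (n - 1)%:R * (cutr R0 N r * (R0 - r) `^ (1 - s)) -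
  \sum_(1 <= k < m.+1) (n - 1)%:R / R0 ^+ k * (R0 - r) `^ (k%:R - s).

Lemma I_m_upper (V : R) (W : R -> R) N m :
  s <= N%:R ->
  (forall r, 0 <= r < R0 -> {for r, continuous (fun r => W (R0 - r))}) ->
  (exists C, forall r, 0 <= r < R0 -> profile_gap N m r <= C + V * W (R0 - r)) ->
  exists2 C, 0 <= C & forall rho tau, admissible R0 rho tau ->
    I_m R0 s m (u rho tau) <= C + V * Lam (fun x => u rho tau x * W (R0 - enorm x)).
Proof.
have R0p' := R0p; have s1' := s1.
move=> sN cW [C1 gapC].
have N1 : (0 < N)%N by rewrite -(ltr0n R); lra.
have sN1 : s - 1 <= (N.-1)%:R by have : N%:R = (N.-1)%:R + 1 :> R; [rewrite natr1 prednK|lra].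
pose A1 := (2 / R0) ^+ N * R0 `^ (N%:R + (1 - s)).
pose A2 := (2 / R0) ^+ N.-1 * R0 `^ (N.-1%:R + (1 - s)).
have p2 : 0 <= 2 / R0 by rewrite divr_ge0 // ltW.
have A10 : 0 <= A1 by rewrite mulr_ge0 ?powR_ge0 // exprn_ge0.
have A20 : 0 <= A2 by rewrite mulr_ge0 ?powR_ge0 // exprn_ge0.
pose T := Lam tent0.
have ctent := @tent_at_cc R n R0 R0p.
have T0 : 0 <= T by apply: Lam_ge0 (tent_at_ge0 _).
pose C4 := 32 / R0 ^+ 3.
have C40 : 0 <= C4 by rewrite divr_ge0 // exprn_ge0 // ltW.
pose C5 := N%:R * (2 / R0) * A2 + `|C1|.
have C50 : 0 <= C5 by apply: addr_ge0 => //; apply: mulr_ge0 => //; exact: mulr_ge0.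
exists (A1 * (2 / R0 * n%:R * T + C4 * T) + C5 * T).
  apply: addr_ge0; apply: mulr_ge0 => //; apply: addr_ge0; last exact: mulr_ge0.
  by apply: mulr_ge0 => //; exact: mulr_ge0.
move=> rho tau adm.
have [rr0 rr0R tu] := admissible_tame n R0p adm.
have t0 := test_tau0 adm.
have L_T := Lam_test_le n R0p adm; rewrite -/T in L_T.
have L_0 : 0 <= Lam (u rho tau).
  by apply: Lam_ge0; [exact: (cc_test n R0p adm) | exact: test_ge0].
have [du cD out0] := tu.
have abs_u x : `|u rho tau x| = u rho tau x by exact: test_abs.
pose phi (d : R) := d `^ (1 - s).
pose dphi (d : R) := (1 - s) * d `^ (- s).
have np : nice_profile R0 phi dphi.
  move=> d /andP[d0 _]; split.
    have h := is_derive1_powR (1 - s) d0.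
    by apply: (is_derive_eq h); rewrite /dphi; congr (_ * _ `^ _); ring.
  by apply: cvgMr; exact: powR_continuous.
have cpow (a r : R) : 0 <= r < R0 -> {for r, continuous (fun r => (R0 - r) `^ a)}.
  exact: pow_dist_continuous.
have ccp (a : R) : cc (fun x => u rho tau x * (R0 - enorm x) `^ a).
  exact: (cc_test_radial n R0p (om := fun r => (R0 - r) `^ a) adm (cpow a)).
have ccg : cc (fun x => gradnorm (u rho tau) x * (R0 - enorm x) `^ (1 - s)) by exact: (cc_grad rr0R tu).
have cut_om (r : R) : 0 <= r < R0 -> {for r, continuous (fun r => cutr R0 N r * phi (R0 - r))}.
  move=> rR; apply: (@continuous_at_mul R R (cutr R0 N) (fun r => phi (R0 - r)) r).
    exact: cutr_continuous.
  exact: cpow.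
pose om3 r := (n - 1)%:R * (cutr R0 N r * phi (R0 - r)) + dcut R0 N r * phi (R0 - r)
   - cutoff R0 N r * dphi (R0 - r).
have com3 (r : R) : 0 <= r < R0 -> {for r, continuous om3}.
  move=> rR; apply: cvgB; first (apply: cvgD; first apply: cvgMr).
  - exact: cut_om.
  - apply: (@continuous_at_mul R R (dcut R0 N) (fun r => phi (R0 - r)) r); last exact: cpow.
    exact: dcut_continuous.
  apply: (@continuous_at_mul R R (cutoff R0 N) (fun r => dphi (R0 - r)) r).
    exact: cutoff_continuous.
  by apply: cvgMr; exact: cpow.
have cc3 : cc (fun x => u rho tau x * om3 (enorm x)).
  exact: (cc_test_radial n R0p adm com3).
have E : Lam (fun x => - 'D_x (u rho tau) x * (cutr R0 N (enorm x) * phi (R0 - enorm x))) =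
  Lam (fun x => u rho tau x * om3 (enorm x)).
  have /andP[_ rlt] := rr0R.
  have k1 : continuous (u rho tau) by move=> x; exact: differentiable_continuous.
  have k2 : continuous (fun x => 'D_x (u rho tau) x) by exact: derive_diag_continuous.
  have k3 x : rr0 <= enorm x -> u rho tau x = 0 by move=> /out0[].
  have k4 x : rr0 <= enorm x -> 'D_x (u rho tau) x = 0 by move=> /out0[_]; exact.
  have k5 := rad_derive_diff du.
  exact: (euler_cut R0p N n0 rlt k1 k2 k3 k4 k5 np).
have cDc : cc (fun x => - 'D_x (u rho tau) x * (cutr R0 N (enorm x) * phi (R0 - enorm x))).
  exact: (cc_test_derive_radial n R0p adm cut_om).
have cD1 := cc_test_derive n R0p adm.
have gradE : Lam (fun x => gradnorm (u rho tau) x * (R0 - enorm x) `^ (1 - s)) <=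
   Lam (fun x => u rho tau x * om3 (enorm x)) +
   A1 * (2 / R0 * (n%:R * Lam (u rho tau)) + C4 * T).
  rewrite -E -(Lam_test_derive n R0p adm) -/T -[C4 * T]LamZ // -[in X in A1 * X]Lam_lin //; last exact: ccZ.
  have cr : cc (fun x => 2 / R0 * (- 'D_x (u rho tau) x) + C4 * tent0 x).
    by apply: cc_lin => //; exact: ccZ.
  rewrite -[A1 * _]LamZ // -LamD //; last exact: ccZ.
  apply: Lam_le => //; first by apply: ccD => //; exact: ccZ.
  move=> x; have D0 := test_derive_ge0 adm x.
  have tt := @tent_at_ge0 R n R0 x.
  have [xR|Rx] := ltP (enorm x) R0; last first.
    rewrite (test_derive_out R0p adm) // (gradnorm_eq0 tu); last first.
      by apply: le_trans Rx; case/andP: rr0R => _ /ltW.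
    by rewrite oppr0 !(mul0r, mulr0) !add0r; apply: mulr_ge0 => //; exact: mulr_ge0.
  have rR : 0 <= enorm x < R0 by rewrite enorm_ge0.
  have b1 : qq R0 (enorm x) ^+ N * (R0 - enorm x) `^ (1 - s) <= A1.
    by apply: qq_pow_bound rR; lra.
  have G0 := gradnorm_ge0 (u rho tau) x.
  have DE := derive_radial_test rho x t0.
  have split_ : gradnorm (u rho tau) x * (R0 - enorm x) `^ (1 - s) =
     - 'D_x (u rho tau) x * (cutr R0 N (enorm x) * phi (R0 - enorm x)) +
     gradnorm (u rho tau) x * (qq R0 (enorm x) ^+ N * (R0 - enorm x) `^ (1 - s)).
    rewrite DE (_ : qq R0 (enorm x) ^+ N = 1 - enorm x * cutr R0 N (enorm x)).
      by rewrite /phi; ring.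
    by rewrite cutr_cutoff // /cutoff; ring.
  rewrite split_ lerD2l mulrC.
  have gle : gradnorm (u rho tau) x <= 2 / R0 * - 'D_x (u rho tau) x + C4 * tent0 x.
    have [h|h] := leP (R0 / 2) (enorm x).
      have : gradnorm (u rho tau) x <= 2 / R0 * - 'D_x (u rho tau) x.
        rewrite DE mulrA ler_peMl // mulrAC ler_pdivlMr // mul1r; clear - R0p n0 s1 h; lra.
      by have : 0 <= C4 * tent0 x by [rewrite mulr_ge0]; lra.
    have [/andP[a1 a2] /andP[a3 a4]] := adm.
    have rr : 0 <= R0 / 2 < rho by apply/andP; clear - R0p n0 s1 R0p' a1; split; lra.
    have g := gradnorm_test_le t0 rr (ltW h).
    have t1 := tent0_ge1 R0p (ltW xR).
    have D1 : R0 ^+ 2 / 4 <= rho ^+ 2 - (R0 / 2) ^+ 2.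
      by rewrite !exprS !expr0; clear - R0p n0 s1 R0p' a1; nra.
    have D2 : 0 < R0 ^+ 2 / 4 by rewrite divr_gt0 ?exprn_gt0.
    have D3 : 0 < rho ^+ 2 - (R0 / 2) ^+ 2 := lt_le_trans D2 D1.
    have : 2 * tau / (rho ^+ 2 - (R0 / 2) ^+ 2) ^+ 2 * enorm x <= C4.
      apply: (@le_trans _ _ (2 / (R0 ^+ 2 / 4) ^+ 2 * R0)); last first.
        by rewrite le_eqVlt; apply/orP; left; apply/eqP; rewrite /C4; field; rewrite gt_eqF.
      apply: ler_pM; rewrite ?enorm_ge0 ?(ltW xR) //.
        by apply: divr_ge0; [apply: mulr_ge0 => //; exact: ltW | apply: exprn_ge0; exact: ltW].
      apply: ler_pM.
      - by apply: mulr_ge0 => //; exact: ltW.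
      - by rewrite invr_ge0; apply: exprn_ge0; exact: ltW.
      - by rewrite -[leRHS]mulr1 ler_pM2l.
      rewrite lef_pV2 ?posrE ?exprn_gt0 //.
      by apply: lerXn2r; rewrite ?nnegrE ?(ltW D2) ?(ltW D3).
    have : C4 <= C4 * tent0 x by rewrite ler_peMr.
    have : 0 <= 2 / R0 * - 'D_x (u rho tau) x by rewrite mulr_ge0.
    by move: g; clear - R0p n0 s1; lra.
  apply: ler_pM => //.
  have q0 : 0 <= qq R0 (enorm x).
    by have /andP[] : 0 <= qq R0 (enorm x) <= 1 by apply: qq_itv => //; rewrite enorm_ge0 ltW.
  by rewrite mulr_ge0 ?powR_ge0 // exprn_ge0.
have ImE : I_m R0 s m (u rho tau) = Lam (fun x => gradnorm (u rho tau) x * (R0 - enorm x) `^ (1 - s))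
   - (s - 1) * Lam (fun x => u rho tau x * (R0 - enorm x) `^ (- s))
   - \sum_(1 <= k < m.+1) ((n - 1)%:R / R0 ^+ k) * Lam (fun x => u rho tau x * (R0 - enorm x) `^ (k%:R - s)).
  rewrite /I_m (Grad_term_Lam _ rr0R tu) !(Pow_term_Lam rr0R tu).
  congr (_ - _ * _ - _); first by congr Lam; apply/funext => x; rewrite abs_u.
  apply: eq_bigr => k _; rewrite (Pow_term_Lam rr0R tu) opprB.
  by congr (_ * Lam _); apply/funext => x; rewrite abs_u.
rewrite ImE -Lam_sum; last by move=> k; exact: ccp.
pose S x := \sum_(1 <= k < m.+1) ((n - 1)%:R / R0 ^+ k) * (u rho tau x * (R0 - enorm x) `^ (k%:R - s)).
have cS : cc S by apply: cc_sum => k; exact: ccp.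
rewrite -/S.
have cu := cc_test n R0p adm.
have cuW : cc (fun x => u rho tau x * W (R0 - enorm x)) by exact: (cc_test_radial n R0p adm cW).
have main : Lam (fun x => u rho tau x * om3 (enorm x)) <=
   C5 * Lam (u rho tau) + (V * Lam (fun x => u rho tau x * W (R0 - enorm x)) +
   ((s - 1) * Lam (fun x => u rho tau x * (R0 - enorm x) `^ (- s)) + Lam S)).
  rewrite -(Lam_lin (s - 1)) // -(Lam_lin V) //; last exact: cc_lin.
  rewrite -(Lam_lin C5) //; last by do 2 apply: cc_lin => //.
  apply: Lam_le => //; first by do 3 apply: cc_lin => //.
  move=> x; have [xR|Rx] := ltP (enorm x) R0; last first.
    rewrite /S big1_seq; last by move=> k _; rewrite (test_out R0p adm) // mul0r mulr0.
    by rewrite (test_out R0p adm) // !(mul0r, mulr0) !addr0.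
  have rR : 0 <= enorm x < R0 by rewrite enorm_ge0.
  have rR' : 0 <= enorm x <= R0 by rewrite enorm_ge0 ltW.
  have gap := gapC _ rR.
  have SE : S x = u rho tau x * \sum_(1 <= k < m.+1) (n - 1)%:R / R0 ^+ k * (R0 - enorm x) `^ (k%:R - s).
    by rewrite /S mulr_sumr; apply: eq_bigr => k _; ring.
  rewrite SE (_ : _ + _ = u rho tau x * (C5 + V * W (R0 - enorm x) + (s - 1) * (R0 - enorm x) `^ (- s) +
     \sum_(1 <= k < m.+1) (n - 1)%:R / R0 ^+ k * (R0 - enorm x) `^ (k%:R - s))); last by ring.
  apply: ler_wpM2l; first exact: test_ge0.
  rewrite /om3.
  have h1 : dcut R0 N (enorm x) * phi (R0 - enorm x) <= N%:R * (2 / R0) * A2.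
    have b := qq_pow_bound sN1 rR; rewrite -/A2 in b.
    have -> : dcut R0 N (enorm x) * phi (R0 - enorm x) =
      N%:R * (2 * enorm x / R0 ^+ 2) * (qq R0 (enorm x) ^+ N.-1 * (R0 - enorm x) `^ (1 - s)).
      by rewrite /dcut /phi; ring.
    have q0 : 0 <= qq R0 (enorm x).
      by have /andP[] : 0 <= qq R0 (enorm x) <= 1 by exact: qq_itv.
    apply: ler_pM => //.
    - by rewrite mulr_ge0 // divr_ge0 ?exprn_ge0 ?mulr_ge0 ?enorm_ge0 // ltW.
    - by rewrite mulr_ge0 ?powR_ge0 // exprn_ge0.
    apply: ler_wpM2l => //.
    have -> : 2 / R0 = 2 * R0 / R0 ^+ 2 by field; rewrite gt_eqF.
    by rewrite ler_pM2r ?invr_gt0 ?exprn_gt0 // ler_pM2l // ltW.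
  have h2 : - (cutoff R0 N (enorm x) * dphi (R0 - enorm x)) <= (s - 1) * (R0 - enorm x) `^ (- s).
    have -> : - (cutoff R0 N (enorm x) * dphi (R0 - enorm x)) =
      cutoff R0 N (enorm x) * ((s - 1) * (R0 - enorm x) `^ (- s)) by rewrite /dphi; ring.
    have /andP[c0 c1] := cutoff_itv R0p N rR'.
    by rewrite ler_piMl // mulr_ge0 ?powR_ge0 // subr_ge0.
  have := ler_norm C1; rewrite /profile_gap -/(phi (R0 - enorm x)) in gap.
  by move: h1 h2; rewrite /C5; clear - R0p n0 s1 gap; lra.
have h1 : C5 * Lam (u rho tau) <= C5 * T by rewrite ler_wpM2l.
have h2 : A1 * (2 / R0 * (n%:R * Lam (u rho tau)) + C4 * T) <= A1 * (2 / R0 * n%:R * T + C4 * T).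
  by rewrite ler_wpM2l // lerD2r -[leRHS]mulrA ler_wpM2l // ler_wpM2l.
by lra.
Qed.


Lemma gap_bound (V a b b0 : R) (W : R -> R) N m (d0 : R) :
  b0 = s - m%:R - 1 -> 0 <= b0 -> 0 <= V ->
  (forall d, 0 < d <= R0 -> 0 <= W d) ->
  a = (n - 1)%:R / R0 ^+ m.+1 -> b = 2 * (n - 1)%:R / R0 ^+ m.+2 ->
  0 < d0 ->
  (forall d, 0 < d <= R0 -> d <= d0 -> (a + b * d) * d `^ (- b0) <= V * W d) ->
  exists C, forall r, 0 <= r < R0 -> profile_gap N m r <= C + V * W (R0 - r).
Proof.
have R0p' := R0p; have s1' := s1.
move=> b0E b00 V0 W0' aE bE d00 H.
have nn : 0 <= (n - 1)%:R :> R by [].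
have a0 : 0 <= a by rewrite aE divr_ge0 // exprn_ge0 // ltW.
have bp : 0 <= b.
  by rewrite bE; apply: divr_ge0; [exact: mulr_ge0 | apply: exprn_ge0; exact: ltW].
pose Ca := (n - 1)%:R * (N%:R / R0 * (R0 / 2) `^ (1 - s)).
pose Cb := (a + b * R0) * d0 `^ (- b0).
have Ca0 : 0 <= Ca by rewrite !mulr_ge0 ?powR_ge0 // invr_ge0 ltW.
have Cb0 : 0 <= Cb by rewrite mulr_ge0 ?powR_ge0 // addr_ge0 // mulr_ge0 // ltW.
exists (Ca + Cb) => r rR.
have dR := dist_itv rR; have /andP[dp dle] := dR; have /andP[r0 rlt] := rR.
have VW : 0 <= V * W (R0 - r) by rewrite mulr_ge0 // W0'.
set Sm := \sum_(1 <= k < m.+1) (R0 ^+ k)^-1 * (R0 - r) `^ (k%:R - s).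
have gapE : profile_gap N m r = (n - 1)%:R * (cutr R0 N r * (R0 - r) `^ (1 - s) - Sm).
  by rewrite /profile_gap mulrBr /Sm [in RHS]mulr_sumr; congr (_ - _); apply: eq_bigr => k _; rewrite mulrA.
have Sm0 : 0 <= Sm.
  by apply: sumr_ge0 => k _; rewrite mulr_ge0 ?powR_ge0 // invr_ge0 exprn_ge0 // ltW.
have rR' : 0 <= r <= R0 by rewrite r0 ltW.
have [rs|rb] := ltP r (R0 / 2).
  suff : profile_gap N m r <= Ca by lra.
  rewrite gapE ler_wpM2l //.
  have h1 : cutr R0 N r <= N%:R / R0.
    have -> : N%:R / R0 = R0 / R0 ^+ 2 * N%:R by field; rewrite gt_eqF.
    have qi := qq_itv R0p rR'.
    apply: ler_pM.
    - by rewrite divr_ge0 ?exprn_ge0 // ltW.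
    - by apply: sumr_ge0 => j _; rewrite exprn_ge0 //; case/andP: qi.
    - by rewrite ler_pM2r ?invr_gt0 ?exprn_gt0 // ltW.
    apply: (@le_trans _ _ (\sum_(j < N) 1)).
      by apply: ler_sum => j _; rewrite exprn_ile1 //; case/andP: qi.
    by rewrite sumr_const card_ord.
  have h2 : (R0 - r) `^ (1 - s) <= (R0 / 2) `^ (1 - s) by apply: powR_npos_le; lra.
  have : cutr R0 N r * (R0 - r) `^ (1 - s) <= N%:R / R0 * (R0 / 2) `^ (1 - s).
    by apply: ler_pM => //; [exact: cutr_ge0 | exact: powR_ge0].
  by lra.
have rp : 0 < r by lra.
have T := telescope_pow R0p s m dp; rewrite -/Sm in T.
have rd : R0 - (R0 - r) = r by ring.
rewrite rd in T.
have powE : (R0 - r) `^ (m%:R + 1 - s) = (R0 - r) `^ (- b0) by congr (_ `^ _); rewrite b0E; ring.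
have h1 : cutr R0 N r * (R0 - r) `^ (1 - s) - Sm <= (R0 - r) `^ (- b0) / R0 ^+ m / r.
  rewrite ler_pdivlMr // mulrBl mulrAC -[cutr _ _ _ * r]mulrC cutr_cutoff // [Sm * r]mulrC T powE.
  have : cutoff R0 N r * (R0 - r) `^ (1 - s) <= (R0 - r) `^ (1 - s).
    by rewrite ler_piMl ?powR_ge0 //; case/andP: (cutoff_itv R0p N rR').
  by lra.
have h2 : profile_gap N m r <= (a + b * (R0 - r)) * (R0 - r) `^ (- b0).
  rewrite gapE; apply: (@le_trans _ _ ((n - 1)%:R * ((R0 - r) `^ (- b0) / R0 ^+ m / r))).
    by rewrite ler_wpM2l.
  have P0 : 0 <= (n - 1)%:R * ((R0 - r) `^ (- b0) / R0 ^+ m).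
    by rewrite !mulr_ge0 ?powR_ge0 // invr_ge0 exprn_ge0 // ltW.
  have -> : (a + b * (R0 - r)) * (R0 - r) `^ (- b0) =
     (n - 1)%:R * ((R0 - r) `^ (- b0) / R0 ^+ m) * (R0^-1 + 2 * (R0 - r) / R0 ^+ 2).
    by rewrite aE bE !exprS; field; rewrite ?expf_neq0 gt_eqF.
  rewrite mulrA ler_wpM2l // -[leLHS]mul1r ler_pdivrMr //.
  have -> : (R0^-1 + 2 * (R0 - r) / R0 ^+ 2) * r = (r * (3 * R0 - 2 * r)) / R0 ^+ 2.
    by field; rewrite gt_eqF.
  rewrite ler_pdivlMr ?exprn_gt0 // mul1r expr2.
  rewrite -subr_ge0 (_ : _ - _ = (R0 - r) * (2 * r - R0)); last by ring.
  by apply: mulr_ge0; clear - R0p n0 s1 rb dp; lra.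
apply: (le_trans h2).
have [dd0|d0d] := leP (R0 - r) d0.
  by apply: le_trans (H _ dR dd0) _; lra.
suff : (a + b * (R0 - r)) * (R0 - r) `^ (- b0) <= Cb by lra.
apply: ler_pM.
- by rewrite addr_ge0 // mulr_ge0 // ltW.
- exact: powR_ge0.
- by rewrite lerD2l ler_wpM2l.
by apply: powR_npos_le; rewrite ?oppr_le0 // ltW.
Qed.

Lemma pow_small (p e A : R) : 0 < p -> 0 < e -> 0 <= A ->
  exists2 d0, 0 < d0 & forall d, 0 < d <= d0 -> A * d `^ p <= e.
Proof.
move=> p0 e0 A0.
have A1 : 0 < 1 + A by lra.
exists ((e / (1 + A)) `^ p^-1); first by rewrite powR_gt0 // divr_gt0.
move=> d /andP[dp dd].
have h : d `^ p <= e / (1 + A).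
  have -> : e / (1 + A) = ((e / (1 + A)) `^ p^-1) `^ p.
    by rewrite -powRrM mulVf ?gt_eqF // powRr1 // divr_ge0 // ltW.
  by apply: ge0_ler_powR; rewrite ?nnegrE ?powR_ge0 // ltW.
rewrite ler_pdivlMr // in h.
by have := powR_ge0 d p; nra.
Qed.

Lemma LL_pow_bound (p d : R) : 0 < p -> 0 < d <= R0 ->
  LL R0 d <= (1 + p^-1) * R0 `^ p * d `^ (- p).
Proof.
move=> p0 /andP[d0 dR].
have x1 : 1 <= R0 / d by rewrite ler_pdivlMr // mul1r.
have xp : 0 < R0 / d by rewrite divr_gt0.
have -> : (1 + p^-1) * R0 `^ p * d `^ (- p) = (1 + p^-1) * (R0 / d) `^ p.
  by rewrite powRM ?invr_ge0 ?(ltW R0p) ?(ltW d0) // powR_invl ?(ltW d0) // mulrA.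
have LE : LL R0 d = 1 + ln (R0 / d).
  by rewrite /LL -[d / R0]invrK invf_div lnV ?posrE // opprK.
have y1 : 1 <= (R0 / d) `^ p.
  by rewrite -[leLHS](powRr0 (R0 / d)); apply: ler_powR => //; exact: ltW.
have ly : ln (R0 / d) <= p^-1 * (R0 / d) `^ p.
  rewrite ler_pdivlMl // -ln_powR; apply: ltW; apply: ln_sublinear; exact: powR_gt0.
by rewrite LE; nra.
Qed.

Lemma quotient_small (v e c : R) (W : R -> R) m :
  0 < e -> 0 < c ->
  (forall r, 0 <= r < R0 -> {for r, continuous (fun r => W (R0 - r))}) ->
  (forall d, 0 < d <= R0 -> c * W0 R0 d <= W d) ->
  (forall N, exists C, forall r, 0 <= r < R0 -> profile_gap N m r <= C + (v + e / 2) * W (R0 - r)) ->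
  exists w : 'rV[R]_n -> R, [/\ Cc_ball R0 w, w <> (fun=> 0) &
    I_m R0 s m w / Lam (fun x : 'rV[R]_n => `|w x| * W (R0 - enorm x)) < v + e].
Proof.
move=> e0 c0 cW WW gap.
have sN : s <= (intpart s).+1%:R by rewrite ltW // truncnS_gt //; lra.
have [C C0 HC] := I_m_upper sN cW (gap _).
have [rho [tau [adm D]]] := test_divergence R0p n0 ((2 * C / e + 1) / c).
exists (u rho tau).
have cuW : cc (fun x => u rho tau x * W (R0 - enorm x)) by exact: (cc_test_radial n R0p adm cW).
have cu0 : cc (fun x => u rho tau x * W0 R0 (R0 - enorm x)).
  exact: (cc_test_radial n R0p (om := fun r => W0 R0 (R0 - r)) adm (W0_cont R0p)).
have cmp : c * Lam (fun x => u rho tau x * W0 R0 (R0 - enorm x)) <=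
   Lam (fun x => u rho tau x * W (R0 - enorm x)).
  rewrite -LamZ //; apply: Lam_le => //; first exact: ccZ.
  move=> x; have [xR|Rx] := ltP (enorm x) R0; last by rewrite (test_out R0p adm) // !mul0r mulr0.
  by rewrite mulrCA ler_wpM2l ?test_ge0 // WW // dist_itv // enorm_ge0.
set D1 := Lam (fun x => u rho tau x * W (R0 - enorm x)) in cmp *.
have big : 2 * C / e + 1 <= D1.
  apply: le_trans cmp; rewrite ler_pdivrMr // in D; rewrite mulrC; lra.
have Ce0 : 0 <= 2 * C / e by rewrite divr_ge0 ?mulr_ge0 // ltW.
have D1p : 0 < D1 by lra.
split; first exact: admissible_Cc.
- move=> u0; move: D1p; rewrite /D1 u0.
  by rewrite (_ : (fun x => _) = (fun=> 0)) ?Lam0 ?ltxx //; apply/funext => x; rewrite mul0r.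
have -> : Lam (fun x => `|u rho tau x| * W (R0 - enorm x)) = D1.
  by congr Lam; apply/funext => x; rewrite test_abs.
rewrite ltr_pdivrMr //; apply: (le_lt_trans (HC _ _ adm)); rewrite -/D1.
have : 2 * C < e * D1.
  by rewrite -ltr_pdivrMl // mulrC; lra.
by nra.
Qed.

End upper.

(** * The infima *)

Section infima.
Variables (R : realType) (n : nat) (R0 s : R).
Hypothesis R0p : 0 < R0.
Hypothesis n0 : (0 < n)%N.
Hypothesis s1 : 1 <= s.

Lemma Lam_weight_gt0 (w : 'rV[R]_n -> R) (W : R -> R) : Cc_ball R0 w -> w <> (fun=> 0) ->
  (forall r, 0 <= r < R0 -> {for r, continuous (fun r => W (R0 - r))}) ->
  (forall d, 0 < d <= R0 -> 0 < W d) ->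
  0 < Lam (fun x => `|w x| * W (R0 - enorm x)).
Proof.
move=> cw w0 cW Wp.
have [r0 r0R tw] := Cc_tame cw; have /andP[_ rlt] := r0R.
have [x0 wx0] : exists x, w x != 0.
  apply: contrapT => h; apply: w0; apply/funext => x.
  by apply/eqP/negPn/negP => wx; apply: h; exists x.
have xin x : w x != 0 -> 0 <= enorm x < R0.
  move=> wx; rewrite enorm_ge0 /= ltNge; apply/negP => Rx.
  have [_ _ out] := tw; have [e _] := out x (le_trans (ltW rlt) Rx).
  by rewrite e eqxx in wx.
apply: (@Lam_gt0 _ _ _ x0).
- apply: (cc_radial (om := fun r => W (R0 - r)) rlt _ _ cW).
    exact: (tame_norm_continuous tw).
  by move=> x; exact: (tame_norm0 tw).
- move=> x; have [->|/xin xR] := eqVneq (w x) 0; first by rewrite normr0 mul0r.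
  by rewrite mulr_ge0 // ltW // Wp // dist_itv.
by rewrite mulr_gt0 ?normr_gt0 // Wp // dist_itv // xin.
Qed.

Lemma Pow_term_ge0 (b : R) (w : 'rV[R]_n -> R) : Cc_ball R0 w -> 0 <= Pow_term R0 b w.
Proof.
move=> cw; have [r0 r0R tw] := Cc_tame cw.
rewrite (Pow_term_Lam r0R tw); apply: Lam_ge0; first exact: (cc_pow r0R tw).
by move=> x; rewrite mulr_ge0 // powR_ge0.
Qed.

Lemma Log_term_ge0 (g : R) (w : 'rV[R]_n -> R) : Cc_ball R0 w -> 0 <= Log_term R0 g w.
Proof.
move=> cw; have [r0 r0R tw] := Cc_tame cw; have /andP[_ rlt] := r0R.
rewrite (Log_term_Lam R0p r0R tw); apply: Lam_ge0; first exact: (cc_log R0p r0R tw).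
move=> x; have [xR|Rx] := ltP (enorm x) R0.
  by rewrite mulr_ge0 // divr_ge0 ?powR_ge0 // subr_ge0 ltW.
by rewrite (tame_norm0 tw) ?mul0r // (le_trans (ltW rlt)).
Qed.

Lemma hardy_ineq (gam : R) (w : 'rV[R]_n -> R) : 1 < gam -> Cc_ball R0 w ->
  (s - 1) * Pow_term R0 s w
  + \sum_(1 <= k < intpart s) ((n - 1)%:R / R0 ^+ k) * Pow_term R0 (s - k%:R) w
  + (gam - 1) / R0 `^ (s - 1) * Log_term R0 gam w <= Grad_term R0 s w.
Proof.
move=> g1 cw; have [r0 r0R tw] := Cc_tame cw.
exact: (hardy_ineq_tame R0p n0 s1 g1 r0R tw).
Qed.

Lemma I_m_lower m (w : 'rV[R]_n -> R) : (m < intpart s)%N -> Cc_ball R0 w ->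
  \sum_(m.+1 <= k < intpart s) ((n - 1)%:R / R0 ^+ k) * Pow_term R0 (s - k%:R) w
    <= I_m R0 s m w.
Proof.
move=> ms cw; have := hardy_ineq (ltr1n R 2) cw.
rewrite (big_cat_nat (n := m.+1)) //= /I_m.
have : 0 <= (2 - 1) / R0 `^ (s - 1) * Log_term R0 2 w.
  apply: mulr_ge0; last exact: Log_term_ge0.
  by apply: divr_ge0; [lra | exact: powR_ge0].
by lra.
Qed.

Lemma infimum_quotient (v c : R) (W : R -> R) m (Den : ('rV[R]_n -> R) -> R) :
  (forall w, Cc_ball R0 w -> Den w = Lam (fun x => `|w x| * W (R0 - enorm x))) ->
  (forall w, Cc_ball R0 w -> v * Den w <= I_m R0 s m w) ->
  0 < c ->
  (forall r, 0 <= r < R0 -> {for r, continuous (fun r => W (R0 - r))}) ->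
  (forall d, 0 < d <= R0 -> 0 < W d) ->
  (forall d, 0 < d <= R0 -> c * W0 R0 d <= W d) ->
  (forall e N, 0 < e -> exists C, forall r, 0 <= r < R0 ->
     profile_gap n R0 s N m r <= C + (v + e) * W (R0 - r)) ->
  is_infimum [set I_m R0 s m w / Den w
    | w in [set w : 'rV[R]_n -> R | Cc_ball R0 w /\ w <> (fun=> 0)]] v.
Proof.
move=> DE lower c0 cW Wp WW gap; split.
  move=> _ [w [cw w0] <-].
  have D0 : 0 < Den w by rewrite DE //; exact: Lam_weight_gt0.
  by rewrite ler_pdivlMr // lower.
move=> e e0.
have e20 : 0 < e / 2 by exact: divr_gt0.
have [w [cw w0 lt]] := quotient_small R0p n0 s1 e0 c0 cW WW (fun N => gap (e / 2) N e20).
exists (I_m R0 s m w / Den w); first by exists w.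
by rewrite DE.
Qed.

Let a m : R := (n - 1)%:R / R0 ^+ m.+1.
Let b m : R := 2 * (n - 1)%:R / R0 ^+ m.+2.

Let a_ge0 m : 0 <= a m.
Proof. by apply: divr_ge0 => //; apply: exprn_ge0; exact: ltW. Qed.

Let b_ge0 m : 0 <= b m.
Proof. by apply: divr_ge0; [exact: mulr_ge0 | apply: exprn_ge0; exact: ltW]. Qed.

Lemma pow_weight_dominates (be d : R) : 1 <= be -> 0 < d <= R0 ->
  R0 `^ (1 - be) * W0 R0 d <= d `^ (- be).
Proof.
move=> be1 dR; have L1 := LL_ge1 R0p dR; case/andP: dR => d0 dR.
have -> : d `^ (- be) = d `^ (1 - be) / d.
  rewrite -(powR_inv1 (ltW d0)) -powRD ?(gt_eqF d0) ?implybT //.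
  by congr (_ `^ _); ring.
rewrite /W0 mulrA ler_pM2r ?invr_gt0 //.
apply: (@le_trans _ _ (R0 `^ (1 - be))); last by apply: powR_npos_le => //; lra.
rewrite ler_piMr ?powR_ge0 // -[leRHS](powRr0 (LL R0 d)).
by apply: ler_powR => //; lra.
Qed.

Lemma infimum_pow m (be : R) : (m.+1 < intpart s)%N -> s - m%:R - 1 <= be ->
  is_infimum [set I_m R0 s m w / Pow_term R0 be w
    | w in [set w : 'rV[R]_n -> R | Cc_ball R0 w /\ w <> (fun=> 0)]]
    (if be == s - m%:R - 1 then (n - 1)%:R / R0 ^+ m.+1 else 0).
Proof.
move=> ms bes; have R0p' := R0p.
have ips := intpart_le s1.
have b1 : 1 <= s - m%:R - 1.
  have : m.+2%:R <= (intpart s)%:R :> R by rewrite ler_nat.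
  by rewrite -2!natr1; lra.
have be1 : 1 <= be by exact: le_trans b1 bes.
have b0 : 0 <= s - m%:R - 1 by lra.
apply: (@infimum_quotient _ (R0 `^ (1 - be)) (fun d => d `^ (- be))).
- move=> w cw; have [r0 r0R tw] := Cc_tame cw; exact: (Pow_term_Lam r0R tw).
- move=> w cw; have := I_m_lower (ltnW ms) cw.
  rewrite big_ltn //= => h.
  have rest : 0 <= \sum_(m.+2 <= k < intpart s) ((n - 1)%:R / R0 ^+ k) * Pow_term R0 (s - k%:R) w.
    apply: sumr_ge0 => k _; apply: mulr_ge0; last exact: Pow_term_ge0.
    by apply: divr_ge0 => //; apply: exprn_ge0; exact: ltW.
  have first : 0 <= a m * Pow_term R0 (s - m.+1%:R) w.
    by apply: mulr_ge0 => //; exact: Pow_term_ge0.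
  rewrite -/(a m) in h *.
  case: eqP => [beE|_]; last by rewrite mul0r; lra.
  have -> : be = s - m.+1%:R by rewrite beE -natr1; ring.
  by lra.
- exact: powR_gt0.
- exact: pow_dist_continuous.
- by move=> d /andP[d0 _]; exact: powR_gt0.
- by move=> d; exact: pow_weight_dominates.
move=> e N e0; rewrite -/(a m).
have W0' d : 0 < d <= R0 -> 0 <= d `^ (- be) by move=> _; exact: powR_ge0.
case: eqP => [beE|/eqP bene].
  have b1p : 0 < 1 + b m by have := b_ge0 m; lra.
  apply: (gap_bound R0p s1 (d0 := e / (1 + b m)) N erefl b0 _ W0' erefl erefl).
  - by rewrite addr_ge0 // ltW.
  - exact: divr_gt0.
  move=> d /andP[d0 _]; rewrite ler_pdivlMr // => dd.
  rewrite -beE ler_wpM2r ?powR_ge0 // -/(a m) -/(b m) lerD2l.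
  by have := b_ge0 m; nra.
have p0 : 0 < be - (s - m%:R - 1) by rewrite subr_gt0 lt_neqAle eq_sym bene.
have ab : 0 <= a m + b m * R0 by rewrite addr_ge0 // mulr_ge0 // ltW.
have [d0 d00 Hd] := pow_small p0 e0 ab.
rewrite add0r; apply: (gap_bound R0p s1 (d0 := d0) N erefl b0 (ltW e0) W0' erefl erefl d00).
move=> d /andP[dp dR] dd; rewrite -/(a m) -/(b m).
have -> : d `^ (- (s - m%:R - 1)) = d `^ (be - (s - m%:R - 1)) * d `^ (- be).
  by rewrite -powRD ?(gt_eqF dp) ?implybT //; congr (_ `^ _); ring.
rewrite mulrA ler_wpM2r ?powR_ge0 //.
apply: le_trans (Hd d _); last by rewrite dp.
by rewrite ler_wpM2r ?powR_ge0 // lerD2l ler_wpM2l.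
Qed.

Lemma infimum_log m : m.+1 = intpart s ->
  is_infimum [set I_m R0 s m w / Log_term R0 1 w
    | w in [set w : 'rV[R]_n -> R | Cc_ball R0 w /\ w <> (fun=> 0)]] 0.
Proof.
move=> ms; have R0p' := R0p.
have mE : s - m%:R - 1 = s - (intpart s)%:R by rewrite -ms -natr1; ring.
have b0 : 0 <= s - m%:R - 1 by rewrite mE subr_ge0; exact: intpart_le.
have b1 : s - m%:R - 1 < 1.
  rewrite mE ltrBlDr addrC natr1; apply: truncnS_gt.
have I0 (w : 'rV[R]_n -> R) : Cc_ball R0 w -> 0 <= I_m R0 s m w.
  move=> cw; have ms' : (m < intpart s)%N by rewrite -ms.
  by have := I_m_lower ms' cw; rewrite big_geq // ms.
clear ms mE.
have Wp d : 0 < d <= R0 -> 0 < W0 R0 d.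
  move=> dR; have L1 := LL_ge1 R0p dR; case/andP: dR => d0 _.
  by rewrite divr_gt0 // powR_gt0; lra.
apply: (@infimum_quotient _ 1 (W0 R0)).
- move=> w cw; have [r0 r0R tw] := Cc_tame cw; exact: (Log_term_Lam R0p r0R tw).
- by move=> w cw; rewrite mul0r; exact: I0.
- exact: ltr01.
- exact: W0_cont.
- exact: Wp.
- by move=> d _; rewrite mul1r.
move=> e N e0; rewrite add0r.
set p := (1 - (s - m%:R - 1)) / 2.
have p0 : 0 < p by rewrite /p; lra.
have ab : 0 <= a m + b m * R0 by rewrite addr_ge0 // mulr_ge0 // ltW.
pose K := (1 + p^-1) * R0 `^ p.
have K0 : 0 <= K by rewrite mulr_ge0 ?powR_ge0 // addr_ge0 // invr_ge0 ltW.
have [d0 d00 Hd] := pow_small p0 e0 (mulr_ge0 ab K0).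
have W0' d : 0 < d <= R0 -> 0 <= W0 R0 d by move=> /Wp/ltW.
apply: (gap_bound R0p s1 (d0 := d0) N erefl b0 (ltW e0) W0' erefl erefl d00).
move=> d dR dd; rewrite -/(a m) -/(b m).
have L1 := LL_ge1 R0p dR; have Lb := LL_pow_bound R0p p0 dR; rewrite -/K in Lb.
case/andP: dR => dp dR.
rewrite /W0 powR_inv1; last by lra.
rewrite mulrA ler_pdivlMr // ler_pdivlMr; last by lra.
have dE : d `^ (- (s - m%:R - 1)) * d = d `^ p * d `^ p.
  rewrite -powRD ?(gt_eqF dp) ?implybT // -[X in _ * X](powRr1 (ltW dp)).
  by rewrite -powRD ?(gt_eqF dp) ?implybT //; congr (_ `^ _); rewrite /p; field.
rewrite [leLHS](_ : _ = (a m + b m * d) * (d `^ (- (s - m%:R - 1)) * d * LL R0 d)); last by ring.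
rewrite dE -(mulrA (d `^ p)).
apply: (@le_trans _ _ ((a m + b m * R0) * (d `^ p * (d `^ p * (K * d `^ (- p)))))).
  apply: ler_pM.
  - by apply: addr_ge0 => //; apply: mulr_ge0 => //; exact: ltW.
  - do 2 (apply: mulr_ge0; first exact: powR_ge0); exact: le_trans ler01 L1.
  - by rewrite lerD2l ler_wpM2l.
  by do 2 (rewrite ler_wpM2l ?powR_ge0 //).
apply: le_trans (Hd d _); last by rewrite dp.
have pp : d `^ p * d `^ (- p) = 1 by rewrite -powRD ?(gt_eqF dp) ?implybT // subrr powRr0.
rewrite le_eqVlt; apply/orP; left; apply/eqP.
transitivity ((a m + b m * R0) * K * d `^ p * (d `^ p * d `^ (- p))); first by ring.
by rewrite pp mulr1.
Qed.

End infima.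
Theorem theorem5p1 (R : realType) (n : nat) (R0 : R) :
  (2 <= n)%N -> 0 < R0 ->
  (forall s : R, 2 <= s ->
     (* inequality, gamma > 1 *)
     (forall gamma : R, 1 < gamma ->
        exists C : R, gamma - 1 <= C /\
          forall u : 'rV[R]_n -> R, Cc_ball R0 u ->
            Grad_term R0 s u >=
              (s - 1) * Pow_term R0 s u
              + \sum_(1 <= k < intpart s) ((n - 1)%:R / R0 ^+ k) * Pow_term R0 (s - k%:R) u
              + C / R0 `^ (s - 1) * Log_term R0 gamma u)
     (* optimality of exponents and constants *)
  /\ (forall m : nat, (m <= (intpart s).-2)%N ->
        forall beta : R, s - m%:R - 1 <= beta ->
          is_infimum
            [set I_m R0 s m u / Pow_term R0 beta u
              | u in [set u : 'rV[R]_n -> R | Cc_ball R0 u /\ u <> (fun=> 0)]]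
            (if beta == s - m%:R - 1 then (n - 1)%:R / R0 ^+ m.+1 else 0))
     (* failure for gamma = 1 *)
  /\ is_infimum
        [set I_m R0 s (intpart s).-1 u / Log_term R0 1 u
          | u in [set u : 'rV[R]_n -> R | Cc_ball R0 u /\ u <> (fun=> 0)]] 0)
  /\
  (forall s : R, 1 <= s < 2 ->
     (forall gamma : R, 1 < gamma ->
        exists C : R, gamma - 1 <= C /\
          forall u : 'rV[R]_n -> R, Cc_ball R0 u ->
            Grad_term R0 s u >=
              (s - 1) * Pow_term R0 s u + C / R0 `^ (s - 1) * Log_term R0 gamma u)
  /\ is_infimum
        [set I_m R0 s 0 u / Log_term R0 1 u
          | u in [set u : 'rV[R]_n -> R | Cc_ball R0 u /\ u <> (fun=> 0)]] 0).

Proof.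
move=> n2 R0p; have n0 : (0 < n)%N := ltnW n2.
split=> [s s2|s /andP[s1 s2]].
  have s1 : 1 <= s by apply: le_trans s2; rewrite ler1n.
  have ip2 : (2 <= intpart s)%N by rewrite /intpart truncn_ge_nat // (le_trans ler01 s1).
  split; [|split].
  - move=> gam g1; exists (gam - 1); split=> // u cu; exact: hardy_ineq.
  - move=> m hm be hbe; apply: infimum_pow => //.
    by move: ip2 hm; case: (intpart s) => [|[|k]].
  - by apply: infimum_log => //; rewrite prednK // intpart_gt0.
have ip1 : intpart s = 1%N.
  apply/eqP; rewrite eqn_leq intpart_gt0 // andbT -ltnS -(ltr_nat R).
  by apply: le_lt_trans s2; exact: intpart_le.
split.
  move=> gam g1; exists (gam - 1); split=> // u cu.
  by have := hardy_ineq R0p n0 s1 g1 cu; rewrite ip1 big_geq // addr0.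
by apply: infimum_log => //; rewrite ip1.
Qed.
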